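(* Let $C$ be a convex disc in the plane. The dual blocking number is $A(C)=11$ if $C$ is not a parallelogram and $A(C)=8$ if $C$ is a parallelogram. The dual strict blocking number is $A'(C)=12$, both if $C$ is not a parallelogram and if $C$ is a parallelogram.
   Context: A convex disc is a convex body (compact convex set with non-empty interior) in $\mathbb{R}^2$. Two convex bodies touch if they intersect but have disjoint interiors; they overlap if their interiors intersect. A collection $\{x_i+C : i\in I\}$ of translates of $C$ that all touch $C$ has a natural cyclic ordering, given by the cyclic ordering around the origin $o$ of the translation vectors $x_i$ (which lie on the boundary of a centrally symmetric convex disc homothetic to $\frac12(C-C)$). A dual Hadwiger family of $C$ is a collection of translates $C+x_i$ of $C$, all touching $C$, such that any two consecutive (in the natural cyclic ordering) translates are not disjoint (they touch or overlap), and such that $o$ is in the convex hull of the translation vectors $x_i$. A dual strict Hadwiger family of $C$ is a collection of translates of $C$, all touching $C$, such that any two consecutive translates overlap, and such that $o$ is in the convex hull of the translation vectors. A dual (strict) Hadwiger family is minimal if no proper subcollection of it is a dual (strict) Hadwiger family of $C$. $A(C)$ is the maximum size of a minimal dual Hadwiger family of $C$, and $A'(C)$ is the maximum size of a minimal dual strict Hadwiger family of $C$. (In the norm with unit ball $B=\frac12(C-C)$, dual [strict] Hadwiger families correspond to sets of points on $\partial B$ containing $o$ in their convex hull with cyclically consecutive points at distance $\leq 1$ [$<1$].) *)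

(* Defs.v *)
From HB Require Import structures.
From mathcomp Require Import all_boot all_order all_algebra.
From mathcomp Require Import all_classical all_reals all_analysis.
Import Order.TTheory GRing.Theory Num.Theory.
Import numFieldNormedType.Exports.

Set Implicit Arguments.
Unset Strict Implicit.
Unset Printing Implicit Defensive.

Local Open Scope classical_set_scope.
Local Open Scope card_scope.
Local Open Scope ring_scope.

Section dual_hadwiger_families.
Context {R : realType}.
Local Notation plane := 'rV[R]_2.
Implicit Types (A B C S T : set plane) (u v x y z : plane).

Definition convex_disc C := [/\ compact C, convex_set C & interior C !=set0].

Definition parallelogram C := exists p u v,
  (forall a b : R, a *: u + b *: v = 0 -> a = 0 /\ b = 0) /\
  C = [set z | exists a b : R,
                 [/\ 0 <= a <= 1, 0 <= b <= 1 & z = p + a *: u + b *: v]].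

Definition translate C x : set plane := [set z + x | z in C].

Definition overlap A B := interior A `&` interior B !=set0.

Definition touch A B := A `&` B !=set0 /\ ~ overlap A B.

Definition convex_hull S : set plane := smallest (@convex_set R plane) S.

Definition rotation (t : R) v : plane :=
  \row_j (if j == ord0 then cos t * v ord0 ord0 - sin t * v ord0 ord_max
          else sin t * v ord0 ord0 + cos t * v ord0 ord_max).

(* A ray from the origin turning counterclockwise from the direction of x
   passes strictly through the direction of z before it first reaches the
   direction of y. *)
Definition cyclically_between x z y := exists s t a b : R,
  [/\ 0 < s < t, t < 2 * pi, 0 < a, 0 < b
    & z = a *: rotation s x /\ y = b *: rotation t x].

(* y is the counterclockwise successor of x in S. Vectors x with translate C x
   touching C lie on the boundary of C - C, so no two of them have the same
   direction. *)
Definition consecutive S x y :=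
  [/\ S x, S y, x != y & forall z, S z -> ~ cyclically_between x z y].

(* A family of translates of C is represented by its set of translation vectors.
   Finiteness is not imposed; the minimal families turn out to be finite. *)
Definition dual_hadwiger C S :=
  [/\ forall x, S x -> touch (translate C x) C,
      forall x y, consecutive S x y -> translate C x `&` translate C y !=set0
    & convex_hull S 0].

Definition dual_strict_hadwiger C S :=
  [/\ forall x, S x -> touch (translate C x) C,
      forall x y, consecutive S x y -> overlap (translate C x) (translate C y)
    & convex_hull S 0].

Definition minimal_family (F : set plane -> Prop) S :=
  F S /\ forall T, T `<` S -> ~ F T.

Definition max_card (F : set plane -> Prop) (n : nat) :=
  (exists2 S, F S & S #= `I_n) /\ (forall S, F S -> S #<= `I_n).

Definition dual_blocking_number C (n : nat) :=
  max_card (minimal_family (dual_hadwiger C)) n.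

Definition dual_strict_blocking_number C (n : nat) :=
  max_card (minimal_family (dual_strict_hadwiger C)) n.

End dual_hadwiger_families.

(* Main.v *)
(** Let [N] be the norm with unit ball [C - C].  A translate of [C] touches [C]
    iff its vector is a unit vector, and two translates meet (overlap) iff their
    vectors are at distance at most (less than) 1.  Chords of the unit circle grow
    with the arc inside a half turn, so adding vectors to a family keeps it a
    family; a minimal family is then a cyclic sequence of points with consecutive
    distances at most 1 and distances more than 1 between every second point
    (less than 1 and at least 1 in the strict case).

    Upper bounds.  Three consecutive chords longer than 1 exceed a half turn,
    because a unit chord extends to an inscribed affine regular hexagon; hence
    every six double steps exceed a full turn and there are at most 11 points.
    In a maximum norm such a chord starting beyond the midpoint of a side of the
    unit square ends beyond the midpoint of the next side, and the bound drops to
    8.  In the strict case six double steps can fail to make a full turn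
    only at points parallel to a segment of length greater than 1 of the unit
    circle, and there are at most two such pairs of antipodal points.

    Lower bounds.  Unless [C] is a parallelogram there is an inscribed affine
    regular hexagon none of whose vertices is parallel to such a segment.  This
    hexagon and a second one interlacing it give 12 points; perturbing its
    vertices along two turns gives 11.  Parallelograms are handled explicitly. *)
Require Import Defs.
From mathcomp Require Import all_boot all_order all_algebra.
From mathcomp Require Import all_classical all_reals all_analysis.
From mathcomp Require Import ring lra.
Import Order.TTheory GRing.Theory Num.Theory.
Import numFieldNormedType.Exports.
Set Implicit Arguments.
Unset Strict Implicit.
Unset Printing Implicit Defensive.
Local Open Scope classical_set_scope.
Local Open Scope ring_scope.

(** The obstacle is that the norm need not be strictly convex. Chords grow only weakly with the arc,
    and a vector can have several points at distance 1 from it on the same side. The triangle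
    inequality shows that this happens only parallel to a segment of length greater than 1 on the
    unit circle. Two such directions that are not parallel control each other: each passes through
    the interior of an edge parallel to the other, so the unit ball is confined to the parallelogram
    that they span, and no third direction fits.

    The weak and the strict bound differ by one because six double steps longer than 1 strictly
    exceed a full turn, while six double steps of length exactly 1 can close up after one turn, as
    two interlaced hexagons do. Since 11 is odd, an extremal weak family cannot be centrally
    symmetric, so its double steps have to be followed through two full turns. *)

Record plane_norm (R : realType) := PlaneNorm {
  nrm :> 'rV[R]_2 -> R;
  nrm_add : forall x y, nrm (x + y) <= nrm x + nrm y;
  nrm_scale : forall a x, nrm (a *: x) = `|a| * nrm x;
  nrm_eq0 : forall x, nrm x = 0 -> x = 0 }.

Ltac vec := apply/rowP => ?; rewrite ?mxE; ring.

(** * Norms in the plane *)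

Section norm.
Context {R : realType}.
Local Notation plane := 'rV[R]_2.
Variable N : plane_norm R.
Implicit Types (x y z u v w t : plane) (a b c : R).

Lemma nrmN x : N (- x) = N x.
Proof. by rewrite -scaleN1r nrm_scale normrN1 mul1r. Qed.

Lemma nrmB x y : N (x - y) = N (y - x).
Proof. by rewrite -nrmN opprB. Qed.

Lemma nrm0 : N 0 = 0.
Proof. by rewrite -(scale0r 0) nrm_scale normr0 mul0r. Qed.

Lemma nrm_ge0 x : 0 <= N x.
Proof.
have := nrm_add N x (- x); rewrite nrmN subrr nrm0 => h; lra.
Qed.

Lemma nrm_gt0 x : x != 0 -> 0 < N x.
Proof.
move=> xN0; rewrite lt_neqAle nrm_ge0 andbT eq_sym.
by apply: contra xN0 => /eqP /nrm_eq0 ->.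
Qed.

Lemma nrm_scale_ge0 a x : 0 <= a -> N (a *: x) = a * N x.
Proof. by move=> a0; rewrite nrm_scale ger0_norm. Qed.

Lemma nrm_comb a b x y : 0 <= a -> 0 <= b ->
  N (a *: x + b *: y) <= a * N x + b * N y.
Proof. by move=> a0 b0; rewrite -!nrm_scale_ge0 // nrm_add. Qed.

Lemma unit_neq0 x : N x = 1 -> x != 0.
Proof.
by move=> x1; apply/eqP => x0; move: x1; rewrite x0 nrm0 => /eqP; rewrite eq_sym oner_eq0.
Qed.

(* The diagonals [0, y] and [x, z] of the quadrilateral 0, x, y, z cross. *)
Lemma nrm_sector x z a b : N x = 1 -> N z = 1 -> 0 <= a -> 0 <= b ->
  N (a *: x + b *: z) = 1 -> N (x - (a *: x + b *: z)) <= N (x - z).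
Proof.
move=> x1 z1 a0 b0; set y := a *: x + b *: z => y1.
have s1 : 1 <= a + b by have := nrm_comb x z a0 b0; rewrite -/y y1 x1 z1 !mulr1.
have s0 : 0 < a + b by lra.
have h1 : a + b <= 1 + a * N (x - z).
  have -> : a + b = N (1 *: y + a *: (z - x)).
    have -> : 1 *: y + a *: (z - x) = (a + b) *: z by rewrite /y; vec.
    by rewrite nrm_scale_ge0 ?z1 ?mulr1 // ltW.
  by apply: le_trans (nrm_comb _ _ _ _) _; rewrite // y1 mul1r nrmB.
have h2 : (a + b) * N (x - y) <= b * N (x - z) + (a + b - 1).
  have -> : (a + b) * N (x - y) = N (b *: (x - z) + (a + b - 1) *: (- y)).
    have -> : b *: (x - z) + (a + b - 1) *: (- y) = (a + b) *: (x - y).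
      by rewrite /y; vec.
    by rewrite nrm_scale_ge0 // ltW.
  by apply: le_trans (nrm_comb _ _ _ _) _; rewrite ?nrmN ?y1 ?mulr1 //; lra.
by rewrite -(ler_pM2l s0); lra.
Qed.

(** Both bounds on [b] are triangle inequalities among [y], [y - x], [z] and [z - x]. The sign of
    [a - 1] decides which combination has nonnegative coefficients. *)
Lemma flat_pos x z a b : N x = 1 -> N z = 1 -> N (z - x) = 1 ->
  0 <= a -> 0 <= b ->
  N (a *: x + b *: z) = 1 -> N (a *: x + b *: z - x) = 1 -> b = 1.
Proof.
move=> x1 z1 zx1 a0 b0; set y := a *: x + b *: z => y1 yx1.
have s1 : 1 <= a + b by have := nrm_comb x z a0 b0; rewrite -/y y1 x1 z1 !mulr1.
apply/eqP; rewrite eq_le; apply/andP; split.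
  have [a1|a1] := leP a 1.
    have := nrm_comb y (y - x) (_ : 0 <= 1 - a) a0; rewrite y1 yx1.
    have -> : (1 - a) *: y + a *: (y - x) = b *: z by rewrite /y; vec.
    rewrite nrm_scale_ge0 // z1 => h.
    have := h _; lra.
  have := nrm_comb (z - x) (y - x) (_ : 0 <= a - 1) (ler01 : 0 <= 1 :> R).
  have -> : (a - 1) *: (z - x) + 1 *: (y - x) = (a - 1 + b) *: z by rewrite /y; vec.
  rewrite zx1 yx1 nrm_scale_ge0 ?z1; [|lra] => h.
  have := h _; lra.
have [a1|a1] := ltP a 1.
  have := nrm_comb (z - x) z (_ : 0 <= 1 - a) (_ : 0 <= b - (1 - a)).
  have -> : (1 - a) *: (z - x) + (b - (1 - a)) *: z = y - x by rewrite /y; vec.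
  rewrite yx1 zx1 z1 => h.
  have := h _ _; lra.
have := nrm_comb y z (_ : 0 <= a - 1) b0.
have -> : (a - 1) *: y + b *: z = a *: (y - x) by rewrite /y; vec.
rewrite nrm_scale_ge0 // yx1 y1 z1 => h.
have := h _; lra.
Qed.

(** For [a < 0] the roles of [y] and [z] are exchanged: [z] is a nonnegative combination of [x] and
    [y] with coefficient [b^-1] at [y]. *)
Lemma flat_ge0 x z a b : N x = 1 -> N z = 1 -> N (z - x) = 1 -> 0 <= b ->
  N (a *: x + b *: z) = 1 -> N (a *: x + b *: z - x) = 1 -> b = 1.
Proof.
move=> x1 z1 zx1 b0; set y := a *: x + b *: z => y1 yx1.
have [a0|a0] := leP 0 a; first exact: (flat_pos x1 z1 zx1 a0 b0 y1 yx1).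
have [b00|bN0] := eqVneq b 0.
  have : N y = `|a| by rewrite /y b00 scale0r addr0 nrm_scale x1 mulr1.
  have : N (y - x) = `|a - 1|.
    have -> : y - x = (a - 1) *: x by rewrite /y b00; vec.
    by rewrite nrm_scale x1 mulr1.
  rewrite yx1 y1 !ltr0_norm; lra.
have bp : 0 < b by rewrite lt_neqAle eq_sym bN0.
have ez : (- a / b) *: x + b^-1 *: y = z.
  apply/rowP => i; rewrite /y !mxE; field; exact: bN0.
have aa : 0 <= - a / b by apply: divr_ge0; lra.
have bb : 0 <= b^-1 by rewrite invr_ge0.
have := @flat_pos x y _ _ x1 y1 yx1 aa bb; rewrite ez => /(_ z1 zx1).
by move=> h; rewrite -[b]invrK h invr1.
Qed.

(* All unit chords parallel to [x] lie on one line and its reflection. *)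
Lemma flat x z a b : N x = 1 -> N z = 1 -> N (z - x) = 1 ->
  N (a *: x + b *: z) = 1 -> N (a *: x + b *: z - x) = 1 -> b = 1 \/ b = -1.
Proof.
move=> x1 z1 zx1 y1 yx1.
have [b0|b0] := leP 0 b; [left|right]; first exact: (flat_ge0 x1 z1 zx1 b0 y1 yx1).
have e : (1 - a) *: x + (- b) *: z = x - (a *: x + b *: z) by vec.
have b1 : - b = 1.
  apply: (@flat_ge0 x z (1 - a)) => //; first lra.
    by rewrite e nrmB.
  rewrite e.
  have -> : x - (a *: x + b *: z) - x = - (a *: x + b *: z) by vec.
  by rewrite nrmN.
lra.
Qed.

(* A segment of length [l > 1] on the unit circle, parallel to [v].  These are the
   obstructions to the uniqueness of the points at distance 1 from [v]: if [z - x],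
   [z] and [y = z + a *: x] are unit vectors, then [z] and [y] are both at distance 1
   from [x]. *)
Definition long_edge v z l :=
  [/\ N v = 1, 1 < l, N z = 1, N (z + v) = 1 & N (z + l *: v) = 1].

Definition bad v := exists z l, long_edge v z l.

(** At most 1 by convexity from the two ends. A value below 1 would pull [z + v] below 1, since
    [z + v] lies between [z + m *: v] and one of the ends. *)
Lemma long_edge_unit v z l m : long_edge v z l -> 0 <= m <= l ->
  N (z + m *: v) = 1.
Proof.
move=> [v1 l1 z1 zv1 zl1] /andP[m0 ml].
have l0 : 0 < l by lra.
apply/eqP; rewrite eq_le; apply/andP; split.
  have := nrm_comb z (z + l *: v) (_ : 0 <= l - m) m0.
  have -> : (l - m) *: z + m *: (z + l *: v) = l *: (z + m *: v) by vec.
  rewrite nrm_scale_ge0 ?z1 ?zl1; last lra.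
  move=> h; rewrite -(ler_pM2l l0); have := h _; lra.
have [m1|m1] := leP m 1.
  have := nrm_comb (z + m *: v) (z + l *: v) (_ : 0 <= l - 1) (_ : 0 <= 1 - m).
  have -> : (l - 1) *: (z + m *: v) + (1 - m) *: (z + l *: v) = (l - m) *: (z + v) by vec.
  rewrite nrm_scale_ge0 ?zv1 ?zl1; last lra.
  move=> h; have {}h := h _ _.
  have l10 : 0 < l - 1 by lra.
  rewrite -(ler_pM2l l10); lra.
have := nrm_comb z (z + m *: v) (_ : 0 <= m - 1) (ler01 : 0 <= 1 :> R).
have -> : (m - 1) *: z + 1 *: (z + m *: v) = m *: (z + v) by vec.
rewrite nrm_scale_ge0 // zv1 z1 => h; have := h _; lra.
Qed.

Lemma long_edgeN v z l : long_edge v z l -> long_edge v (- z - l *: v) l.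
Proof.
move=> vzl; have [v1 l1 z1 zv1 zl1] := vzl; split => //.
- by rewrite -opprD nrmN.
- have -> : - z - l *: v + v = - (z + (l - 1) *: v) by vec.
  by rewrite nrmN (long_edge_unit vzl) //; lra.
- have -> : - z - l *: v + l *: v = - z by vec.
  by rewrite nrmN.
Qed.

Lemma long_edge_rev v z l : long_edge v z l -> long_edge (- v) (z + l *: v) l.
Proof.
move=> vzl; have [v1 l1 z1 zv1 zl1] := vzl; split => //.
- by rewrite nrmN.
- have -> : z + l *: v - v = (z + (l - 1) *: v) by vec.
  by rewrite (long_edge_unit vzl) //; lra.
- have -> : z + l *: v + l *: - v = z by vec.
  by [].
Qed.

Lemma badN v : bad v -> bad (- v).
Proof. by move=> [z [l /long_edge_rev]]; exists (z + l *: v), l. Qed.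

(** With [b = 1] the three unit vectors [z - x], [z] and [z + a *: x] lie on one line parallel to
    [x], over a length [1 + a]. *)
Lemma flat_long_edge x z a b : N x = 1 -> N z = 1 -> N (z - x) = 1 ->
  0 < a -> 0 <= b -> N (a *: x + b *: z) = 1 -> N (a *: x + b *: z - x) = 1 ->
  b = 1 /\ long_edge x (z - x) (1 + a).
Proof.
move=> x1 z1 zx1 a0 b0 y1 yx1.
have b1 := flat_pos x1 z1 zx1 (ltW a0) b0 y1 yx1; split => //; split => //.
- lra.
- by rewrite subrK.
- have -> : z - x + (1 + a) *: x = a *: x + b *: z by rewrite b1; vec.
  by [].
Qed.

Lemma long_edge_line v z l y : long_edge v z l -> N y = 1 -> N (y - v) = 1 ->
  forall a b, y = a *: v + b *: z -> b = 1 \/ b = -1.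
Proof.
move=> [v1 l1 z1 zv1 zl1] y1 yv1 a b yE.
have e : (a - b) *: v + b *: (z + v) = y by rewrite yE; vec.
by apply: (@flat v (z + v) (a - b) b); rewrite ?e ?addrK.
Qed.
End norm.

(** * Angles and the unit circle *)

Section angle.
Context {R : realType}.
Local Notation plane := 'rV[R]_2.
Implicit Types (x y z u v w : plane) (a b c t : R).

Definition det2 u v : R := u ord0 ord0 * v ord0 ord_max - u ord0 ord_max * v ord0 ord0.

Definition dir t : plane := \row_j (if j == ord0 then cos t else sin t).

Lemma dir0 t : dir t ord0 ord0 = cos t. Proof. by rewrite mxE. Qed.
Lemma dir1 t : dir t ord0 ord_max = sin t. Proof. by rewrite mxE. Qed.

Lemma planeP u v : u ord0 ord0 = v ord0 ord0 -> u ord0 ord_max = v ord0 ord_max -> u = v.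
Proof.
move=> h0 h1; apply/rowP => -[[|[|//]] lt].
  by have -> : Ordinal lt = ord0 by exact: val_inj.
by have -> : Ordinal lt = ord_max by exact: val_inj.
Qed.

Lemma det2Zl c u v : det2 (c *: u) v = c * det2 u v.
Proof. by rewrite /det2 !mxE; ring. Qed.
Lemma det2Zr c u v : det2 u (c *: v) = c * det2 u v.
Proof. by rewrite /det2 !mxE; ring. Qed.
Lemma det2Nl u v : det2 (- u) v = - det2 u v.
Proof. by rewrite /det2 !mxE; ring. Qed.
Lemma det2Nr u v : det2 u (- v) = - det2 u v.
Proof. by rewrite /det2 !mxE; ring. Qed.
Lemma det2Dl u v w : det2 (u + v) w = det2 u w + det2 v w.
Proof. by rewrite /det2 !mxE; ring. Qed.
Lemma det2Dr u v w : det2 w (u + v) = det2 w u + det2 w v.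
Proof. by rewrite /det2 !mxE; ring. Qed.
Lemma det2vv u : det2 u u = 0.
Proof. by rewrite /det2; ring. Qed.
Lemma det2C u v : det2 v u = - det2 u v.
Proof. by rewrite /det2; ring. Qed.

Lemma cramer u v w : det2 u v *: w = det2 w v *: u + det2 u w *: v.
Proof. by apply: planeP; rewrite /det2 !mxE; ring. Qed.

Lemma cramer_div u v w : det2 u v != 0 ->
  w = (det2 w v / det2 u v) *: u + (det2 u w / det2 u v) *: v.
Proof.
move=> d0; apply: (scalerI d0); rewrite cramer scalerDr !scalerA.
by rewrite !(mulrC (det2 u v)) !divfK.
Qed.

Lemma det2_dir s t : det2 (dir s) (dir t) = sin (t - s).
Proof. by rewrite /det2 !dir0 !dir1 sinB; ring. Qed.

Lemma det2_eq0 u v : det2 u v = 0 -> u != 0 -> exists c, v = c *: u.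
Proof.
move=> d0 uN0; have [x0|x0] := eqVneq (u ord0 ord0) 0; last first.
  exists (v ord0 ord0 / u ord0 ord0); apply: planeP; rewrite !mxE.
    by rewrite divfK.
  apply: (mulfI x0); move: d0; rewrite /det2 => d0.
  have -> : u ord0 ord0 * (v ord0 ord0 / u ord0 ord0 * u ord0 ord_max)
      = v ord0 ord0 * u ord0 ord_max by field.
  lra.
have y0 : u ord0 ord_max != 0.
  by apply: contra uN0 => /eqP y0; apply/eqP/planeP; rewrite ?x0 ?y0 !mxE.
exists (v ord0 ord_max / u ord0 ord_max); apply: planeP; rewrite !mxE.
  move: d0; rewrite /det2 x0 mulr0 mul0r sub0r => /eqP; rewrite oppr_eq0 mulf_eq0.
  by rewrite (negPf y0) => /eqP.
by rewrite divfK.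
Qed.

Lemma dir_neq0 t : dir t != 0.
Proof.
apply/eqP => e0; have := cos2Dsin2 t.
by rewrite -dir0 -dir1 e0 !mxE expr0n /= addr0 => /eqP; rewrite eq_sym oner_eq0.
Qed.

Lemma dirDpi t : dir (t + pi) = - dir t.
Proof. by apply: planeP; rewrite !mxE /= ?cosDpi ?sinDpi. Qed.

Lemma rotation_dir s t : rotation s (dir t) = dir (t + s).
Proof. by apply: planeP; rewrite !mxE /= ?cosD ?sinD; ring. Qed.

Lemma rotationZ s c u : rotation s (c *: u) = c *: rotation s u.
Proof. by apply: planeP; rewrite !mxE /=; ring. Qed.

(** Rotating by [- a] moves the window to [[0, 2 pi)]. There the angle is the arccosine of the
    normalised abscissa, or its reflection below the axis. *)
Lemma polar v a : v != 0 -> exists2 t, a <= t < a + 2 * pi & exists2 c, 0 < c & v = c *: dir t.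
Proof.
move=> vN0; pose w := rotation (- a) v.
pose r2 := w ord0 ord0 ^+ 2 + w ord0 ord_max ^+ 2.
have r2E : r2 = v ord0 ord0 ^+ 2 + v ord0 ord_max ^+ 2.
  rewrite /r2 /w !mxE /= cosN sinN.
  have := cos2Dsin2 a; set C := cos a; set S := sin a => h.
  transitivity ((C ^+ 2 + S ^+ 2) * (v ord0 ord0 ^+ 2 + v ord0 ord_max ^+ 2)); first by ring.
  by rewrite h mul1r.
have r20 : 0 < r2.
  rewrite lt_neqAle r2E addr_ge0 ?sqr_ge0 // andbT eq_sym.
  apply: contra vN0; rewrite paddr_eq0 ?sqr_ge0 // !sqrf_eq0 => /andP[/eqP h0 /eqP h1].
  by apply/eqP/planeP; rewrite ?h0 ?h1 !mxE.
pose r := Num.sqrt r2.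
have r0 : 0 < r by rewrite sqrtr_gt0.
have rr : r ^+ 2 = r2 by rewrite sqr_sqrtr // ltW.
have xle : -1 <= w ord0 ord0 / r <= 1.
  rewrite ler_pdivrMr // ler_pdivlMr // mulN1r mul1r -ler_norml.
  rewrite -(@ler_pXn2r _ 2) // ?nnegrE ?normr_ge0 ?(ltW r0) //.
  by rewrite real_normK ?num_real // rr /r2; have := sqr_ge0 (w ord0 ord_max); lra.
have vE : v = rotation a w.
  apply: planeP; rewrite /w !mxE /= cosN sinN; have := cos2Dsin2 a;
    set C := cos a; set S := sin a => h.
    transitivity ((C ^+ 2 + S ^+ 2) * v ord0 ord0); last by ring.
    by rewrite h mul1r.
  transitivity ((C ^+ 2 + S ^+ 2) * v ord0 ord_max); last by ring.
  by rewrite h mul1r.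
clearbody w.
suff [s s02 wE] : exists2 s, 0 <= s < 2 * pi & w = r *: dir s.
  exists (s + a); first by lra.
  by exists r; rewrite // vE wE rotationZ rotation_dir.
have sE : Num.sqrt (1 - (w ord0 ord0 / r) ^+ 2) = `|w ord0 ord_max| / r.
  have -> : 1 - (w ord0 ord0 / r) ^+ 2 = (`|w ord0 ord_max| / r) ^+ 2.
    rewrite !expr_div_n rr real_normK ?num_real // /r2; field.
    by rewrite -/r2 gt_eqF.
  by rewrite sqrtr_sqr ger0_norm // divr_ge0 // ltW.
have ac0 := acos_ge0 xle; have acp := acos_lepi xle; have pi0 := @pi_gt0 R.
have rN0 : r != 0 by rewrite gt_eqF.
have [y0|y0] := leP 0 (w ord0 ord_max).
  exists (acos (w ord0 ord0 / r)); first by lra.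
  apply: planeP; rewrite !mxE /= ?sin_acos // ?acosK ?in_itv //= ?sE ?ger0_norm //;
    by rewrite mulrC divfK.
exists (2 * pi - acos (w ord0 ord0 / r)).
  rewrite lerBrDl addr0; apply/andP; split; first by lra.
  rewrite ltrBlDr ltrDl acos_gt0 //.
  case/andP: (xle) => -> xle1 /=; rewrite lt_neqAle xle1 andbT.
  apply/eqP => x1; move: sE; rewrite x1 expr1n subrr sqrtr0 => /esym/eqP.
  by rewrite mulf_eq0 invr_eq0 (negPf rN0) orbF normr_eq0 lt_eqF.
have h2 : forall t, 2 * pi - t = - t + pi *+ 2 by move=> t; rewrite -mulr_natl; ring.
apply: planeP; rewrite !mxE /= h2 ?cosD2pi ?sinD2pi ?cosN ?sinN ?sin_acos // ?acosK ?in_itv //=.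
  by rewrite mulrC divfK.
by rewrite sE ltr0_norm // mulNr opprK mulrC divfK.
Qed.

Lemma sin_eq0_2pi a : 0 <= a < 2 * pi -> sin a = 0 -> a = 0 \/ a = pi.
Proof.
move=> h s0; have [|a0] := eqVneq a 0; [by left | right].
have sB : sin (a - pi) = - sin a by rewrite -[in RHS](subrK pi a) sinDpi opprK.
case: (ltgtP a pi) => // ap.
  have : 0 < sin a by apply: sin_gt0_pi; apply/andP; split=> //; lra.
  by rewrite s0 ltxx.
have : 0 < sin (a - pi) by apply: sin_gt0_pi; lra.
by rewrite sB s0 oppr0 ltxx.
Qed.
End angle.

(** * The unit circle parametrised by angle, and its chords *)

Section boundary.
Context {R : realType}.
Local Notation plane := 'rV[R]_2.
Variable N : plane_norm R.
Implicit Types (x y z u v w : plane) (a b c s t : R).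

(** Angles are kept as real numbers instead of residues modulo [2 * pi], so that the order along the
    circle is the order of the reals; a suitable lift is chosen each time. *)
Definition bd t := (N (dir t))^-1 *: dir t.
Definition dist a b := N (bd a - bd b).

Lemma bd_scale_gt0 t : 0 < (N (dir t))^-1.
Proof. by rewrite invr_gt0 nrm_gt0 // dir_neq0. Qed.

Lemma bd_unit t : N (bd t) = 1.
Proof.
rewrite /bd nrm_scale_ge0 ?(ltW (bd_scale_gt0 t)) // mulVf // gt_eqF //.
by rewrite nrm_gt0 // dir_neq0.
Qed.

Lemma bdDpi t : bd (t + pi) = - bd t.
Proof. by rewrite /bd dirDpi nrmN scalerN. Qed.

Lemma bdBpi t : bd (t - pi) = - bd t.
Proof. by rewrite -[in RHS](subrK pi t) bdDpi opprK. Qed.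

Lemma bdD2pi t : bd (t + 2 * pi) = bd t.
Proof. by rewrite mulr_natl mulr2n addrA !bdDpi opprK. Qed.

Lemma bd_dir c t : 0 < c -> N (c *: dir t) = 1 -> c *: dir t = bd t.
Proof.
move=> c0; rewrite nrm_scale_ge0 ?(ltW c0) // /bd => h.
by rewrite -[c](mulfK (_ : N (dir t) != 0)) ?h ?div1r // gt_eqF // nrm_gt0 // dir_neq0.
Qed.

Lemma unit_bd v a : N v = 1 -> exists2 t, a <= t < a + 2 * pi & v = bd t.
Proof.
move=> v1; have [t ta [c c0 vE]] := polar a (unit_neq0 v1).
by exists t => //; rewrite vE bd_dir // -vE.
Qed.

Lemma det2_bd s t :
  det2 (bd s) (bd t) = (N (dir s))^-1 * (N (dir t))^-1 * sin (t - s).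
Proof. by rewrite /bd det2Zl det2Zr det2_dir mulrA. Qed.

Lemma det2_bd_gt0 s t : s < t < s + pi -> 0 < det2 (bd s) (bd t).
Proof.
move=> st; rewrite det2_bd !mulr_gt0 ?bd_scale_gt0 // sin_gt0_pi //; lra.
Qed.

Lemma det2_bd_le0 s t : s + pi <= t <= s + 2 * pi -> det2 (bd s) (bd t) <= 0.
Proof.
move=> st; have -> : bd t = - bd (t - pi) by rewrite bdBpi opprK.
rewrite det2Nr oppr_le0 det2_bd mulr_ge0 ?mulr_ge0 ?(ltW (bd_scale_gt0 _)) //.
by apply: sin_ge0_pi; lra.
Qed.

Lemma bd_det2_gt0 s t : s <= t < s + 2 * pi -> 0 < det2 (bd s) (bd t) ->
  s < t < s + pi.
Proof.
move=> st d0; apply/andP; split.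
  rewrite lt_neqAle; case/andP: st => -> _; rewrite andbT.
  by apply/eqP => e; move: d0; rewrite e det2vv ltxx.
rewrite ltNge; apply/negP => h; have := @det2_bd_le0 s t; lra.
Qed.

Lemma unit_bd_gt0 v s : N v = 1 -> 0 < det2 (bd s) v ->
  exists2 t, s < t < s + pi & v = bd t.
Proof.
move=> /(unit_bd s)[t st ->] d0; exists t => //; exact: bd_det2_gt0.
Qed.

Lemma bd_inj s t : s <= t < s + 2 * pi -> bd s = bd t -> s = t.
Proof.
move=> st e; have := det2_bd s t; rewrite -e det2vv => /esym/eqP.
rewrite mulf_eq0 gt_eqF ?mulr_gt0 ?bd_scale_gt0 //= => /eqP s0.
have : 0 <= t - s < 2 * pi by lra.
move=> /sin_eq0_2pi/(_ s0)[|h]; first by lra.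
have tE : t = s + pi by lra.
have : bd s = 0.
  move: e; rewrite tE bdDpi => e.
  have : 2 *: bd s = 0 by rewrite scaler_nat mulr2n [X in _ + X]e subrr.
  by move/eqP; rewrite scaler_eq0 pnatr_eq0 /= => /eqP.
by move/eqP; rewrite (negPf (unit_neq0 (bd_unit s))).
Qed.

Lemma bd_cone a b c : a < b < c -> c < a + pi ->
  exists al be, [/\ 0 < al, 0 < be & bd b = al *: bd a + be *: bd c].
Proof.
move=> abc ca; have dac : 0 < det2 (bd a) (bd c) by apply: det2_bd_gt0; lra.
exists (det2 (bd b) (bd c) / det2 (bd a) (bd c)), (det2 (bd a) (bd b) / det2 (bd a) (bd c)).
split; [| |by apply: cramer_div; rewrite gt_eqF].
  by apply: divr_gt0 => //; apply: det2_bd_gt0; lra.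
by apply: divr_gt0 => //; apply: det2_bd_gt0; lra.
Qed.

Lemma bd_cone_ge0 a b c : a <= b <= c -> c < a + pi ->
  exists al be, [/\ 0 <= al, 0 <= be & bd b = al *: bd a + be *: bd c].
Proof.
move=> /andP[]; rewrite le_eqVlt => /predU1P[<- _ _|ab].
  by exists 1, 0; rewrite scale1r scale0r addr0.
rewrite le_eqVlt => /predU1P[<- _|bc].
  by exists 0, 1; rewrite scale1r scale0r add0r.
have /bd_cone h : a < b < c by rewrite ab.
move=> /h[al [be [al0 be0 ->]]].
by exists al, be; split => //; exact: ltW.
Qed.

Lemma distC a b : dist a b = dist b a. Proof. exact: nrmB. Qed.

Lemma dist_le2 a b : dist a b <= 2.
Proof.
by apply: le_trans (nrm_add _ _ _) _; rewrite nrmN !bd_unit.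
Qed.

Lemma distDpi a : dist a (a + pi) = 2.
Proof.
by rewrite /dist bdDpi opprK -mulr2n -scaler_nat nrm_scale bd_unit mulr1 ger0_norm.
Qed.

Lemma dist_pi2 a b : dist (a + pi) (b + pi) = dist a b.
Proof. by rewrite /dist !bdDpi -opprD nrmN. Qed.

Lemma dist_2pi a b : dist (a + 2 * pi) (b + 2 * pi) = dist a b.
Proof. by rewrite /dist !bdD2pi. Qed.

Lemma distxx a : dist a a = 0. Proof. by rewrite /dist subrr nrm0. Qed.

(** Below a half turn [bd N b] lies in the cone of the two ends and [nrm_sector] applies. At
    [c = a + pi] the ends are dependent, but the chord is then a diameter, of the greatest possible
    length 2. *)
Lemma dist_mono_r a b c : a <= b <= c -> c <= a + pi -> dist a b <= dist a c.
Proof.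
move=> abc; rewrite le_eqVlt => /predU1P[->|ca]; first by rewrite distDpi dist_le2.
have [al [be [al0 be0 bE]]] := bd_cone_ge0 abc ca.
by rewrite /dist bE nrm_sector ?bd_unit // -bE bd_unit.
Qed.

Lemma dist_mono_l a b c : a <= b <= c -> c <= a + pi -> dist b c <= dist a c.
Proof.
move=> abc; rewrite le_eqVlt => /predU1P[->|ca]; first by rewrite distDpi dist_le2.
have [al [be [al0 be0 bE]]] := bd_cone_ge0 abc ca.
rewrite addrC in bE; rewrite distC [X in _ <= X]distC /dist bE.
by rewrite nrm_sector ?bd_unit // -bE bd_unit.
Qed.

Lemma dist_nest a b c s : a <= b <= c -> c <= s <= a + pi -> dist b c <= dist a s.
Proof.
move=> abc cs; apply: (@le_trans _ _ (dist a c)).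
  by apply: dist_mono_l => //; lra.
by apply: dist_mono_r; lra.
Qed.

(** [r] is the vertex after [a] and [b] in an inscribed affine regular hexagon: by the equation for
    [bd r], the chords from [b] to [r] and from [r] to [a + pi] lose or gain nothing. Precisely,
    [bd b - bd r = bd a] and [bd r + bd a = bd b], so the chord from [b] to [r] and the one from [r]
    to [a + pi] are unit vectors again. *)
Lemma hexagon a b : a < b < a + pi -> dist a b = 1 ->
  exists2 r, b < r < a + pi & bd r = bd b - bd a.
Proof.
move=> ab d1; have dab := det2_bd_gt0 ab.
have r1 : N (bd b - bd a) = 1 by rewrite nrmB.
have [|r br rE] := @unit_bd_gt0 _ b r1.
  by rewrite det2Dr det2vv det2Nr (det2C (bd a)); lra.
exists r => //; apply/andP; split; first lra.
have : 0 < det2 (bd r) (bd (a + pi)).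
  by rewrite bdDpi det2Nr -rE det2Dl det2Nl det2vv (det2C (bd a)); lra.
rewrite ltNge => d0; rewrite ltNge; apply/negP => h.
move: d0 => /negP; apply; rewrite det2C oppr_le0.
have [->|ne] := eqVneq r (a + pi); first by rewrite det2vv.
have lt : a + pi < r by rewrite lt_neqAle eq_sym ne.
by apply/ltW/det2_bd_gt0; lra.
Qed.

Lemma nrm_dist x y : `|N x - N y| <= N (x - y).
Proof.
rewrite ler_norml; apply/andP; split.
  by have := nrm_add N x (y - x); rewrite subrKC nrmB; lra.
by have := nrm_add N y (x - y); rewrite subrKC; lra.
Qed.

(** By the triangle inequality the value changes by at most
    [N u * |f t - f s| + N v * |g t - g s|]. *)
Lemma nrm_comb_continuous (f g : R -> R) u v w : continuous f -> continuous g ->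
  continuous (fun t => N (f t *: u + g t *: v + w)).
Proof.
move=> fc gc t.
pose h s := N u * `|f t - f s| + N v * `|g t - g s|.
have hc : h s @[s --> t] --> (0 : R).
  have -> : 0 = N u * `|f t - f t| + N v * `|g t - g t|.
    by rewrite !subrr normr0 !mulr0 addr0.
  apply: cvgD; apply: cvgMr; apply: cvg_norm; apply: cvgB; try exact: cvg_cst;
    [exact: fc | exact: gc].
apply/cvgrPdist_le => e e0.
move/cvgrPdist_le : hc => /(_ _ e0); apply: filterS => s.
rewrite sub0r normrN => hs; apply: le_trans hs.
apply: le_trans (nrm_dist _ _) _; apply: le_trans _ (ler_norm _).
have -> : f t *: u + g t *: v + w - (f s *: u + g s *: v + w)
   = (f t - f s) *: u + (g t - g s) *: v by vec.
by apply: le_trans (nrm_add _ _ _) _; rewrite !nrm_scale /h ![N _ * _]mulrC.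
Qed.

Lemma dirE t : dir t = cos t *: dir 0 + sin t *: dir (pi / 2).
Proof.
by apply: planeP; rewrite !mxE /= ?cos0 ?sin0 ?cos_pihalf ?sin_pihalf; ring.
Qed.

Lemma dist_continuous a : continuous (dist ^~ a).
Proof.
have Nc : continuous (fun t => (N (dir t))^-1).
  move=> t; apply: cvgV; first by rewrite gt_eqF // nrm_gt0 // dir_neq0.
  have := @nrm_comb_continuous _ _ (dir 0) (dir (pi / 2)) 0 (@continuous_cos R) (@continuous_sin R) t.
  by under [X in X @ _ --> _ -> _]eq_fun => s do rewrite addr0 -dirE; rewrite addr0 -dirE.
have -> : dist ^~ a = fun t => N (((N (dir t))^-1 * cos t) *: dir 0 +
    ((N (dir t))^-1 * sin t) *: dir (pi / 2) + - bd a).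
  by apply/funext => t; rewrite /dist -!scalerA -scalerDr -dirE.
apply: nrm_comb_continuous => t; apply: cvgM; try exact: Nc.
  exact: continuous_cos.
exact: continuous_sin.
Qed.

Lemma dist_ivt a b : a < b -> 1 <= dist a b -> exists2 q, a < q <= b & dist a q = 1.
Proof.
move=> ab d1.
have fc : {within `[a, b], continuous (dist ^~ a)}.
  exact: continuous_subspaceT (@dist_continuous a).
have [] := @IVT R _ a b 1 (ltW ab) fc.
  rewrite distxx (distC b) ge_min le_max ler01 d1 orbT //.
move=> q; rewrite in_itv /= => /andP[aq qb] dq.
exists q; last by rewrite distC.
rewrite qb andbT lt_neqAle aq andbT; apply/eqP => e.
by move: dq; rewrite -e distxx => /eqP; rewrite eq_sym oner_eq0.
Qed.
End boundary.

(** * Long edges of the unit circle *)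

Section long_edges.
Context {R : realType}.
Local Notation plane := 'rV[R]_2.
Variable N : plane_norm R.
Implicit Types (x y z u v w t : plane) (a b c : R).

(** Long edges arise here: they are the price of two unit chords leaving [a] on the same side.
    [flat_l] is the mirror image. *)
Lemma flat_r a b c : a < b < c -> c < a + pi -> dist N a b = 1 -> dist N a c = 1 ->
  exists al, [/\ 0 < al, bd N b = al *: bd N a + bd N c &
    long_edge N (bd N a) (bd N c - bd N a) (1 + al)].
Proof.
move=> abc ca dab dac.
have [al [be [al0 be0 bE]]] := bd_cone N abc ca.
have [|||||be1 le] := @flat_long_edge R N (bd N a) (bd N c) al be _ _ _ al0 (ltW be0);
  rewrite -?bE ?bd_unit //; try by rewrite nrmB.
by exists al; split => //; rewrite bE be1 scale1r.
Qed.

Lemma flat_l a b c : a < b < c -> c < a + pi -> dist N b c = 1 -> dist N a c = 1 ->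
  bad N (bd N c).
Proof.
move=> abc ca dab dac.
have [al [be [al0 be0 bE]]] := bd_cone N abc ca; rewrite addrC in bE.
have [|||||be1 le] := @flat_long_edge R N (bd N c) (bd N a) be al _ _ _ be0 (ltW al0);
  rewrite -?bE ?bd_unit //.
by exists (bd N a - bd N c), (1 + be).
Qed.

(** Dividing by [al + be] moves [bd N b] radially onto the segment. The result is a unit vector in
    the same direction, so [al + be = 1]. *)
Lemma bd_segment a b c : a < b < c -> c < a + pi ->
  (forall s : R, 0 <= s <= 1 -> N (bd N a + s *: (bd N c - bd N a)) = 1) ->
  exists2 s : R, 0 < s < 1 & bd N b = bd N a + s *: (bd N c - bd N a).
Proof.
move=> abc ca seg; have [al [be [al0 be0 bE]]] := bd_cone N abc ca.
have s0 : 0 < al + be by lra.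
have sN0 : al + be != 0 by rewrite gt_eqF.
have s01 : 0 < be / (al + be) < 1.
  apply/andP; split; first exact: divr_gt0.
  by rewrite ltr_pdivrMr // mul1r ltrDr.
have e : bd N b = (al + be) *: (bd N a + (be / (al + be)) *: (bd N c - bd N a)).
  rewrite bE; move: (bd N a) (bd N c) => x z.
  by apply/rowP => i; rewrite !mxE; field.
have s1 : al + be = 1.
  by rewrite -[RHS](bd_unit N b) e nrm_scale_ge0 ?(ltW s0) // seg ?mulr1 //; apply/andP; split; apply: ltW; case/andP: s01.
exists be; first by lra.
by rewrite e s1 divr1 scale1r.
Qed.

Lemma bd_segment_le a b c : a <= b <= c -> a < c < a + pi ->
  (forall s : R, 0 <= s <= 1 -> N (bd N a + s *: (bd N c - bd N a)) = 1) ->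
  exists s, bd N b = bd N a + s *: (bd N c - bd N a).
Proof.
move=> /andP[]; rewrite le_eqVlt => /predU1P[<- _ _ _|ab].
  by exists 0; rewrite scale0r addr0.
rewrite le_eqVlt => /predU1P[<- _ _|bc ca seg].
  by exists 1; rewrite scale1r subrKC.
have [||s _ ->] := @bd_segment a b c _ _ seg; first by rewrite ab bc.
  by case/andP: ca.
by exists s.
Qed.

Lemma long_edge_det v z l : long_edge N v z l -> det2 v z != 0.
Proof.
move=> [v1 _ z1 zv1 _]; apply/eqP => /det2_eq0/(_ (unit_neq0 v1))[c zE].
have c1 : `|c| = 1 by rewrite -[RHS]z1 zE nrm_scale v1 mulr1.
have : `|c + 1| = 1.
  have e : z + v = (c + 1) *: v by rewrite zE; vec.
  by rewrite -[RHS]zv1 e nrm_scale v1 mulr1.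
by move: c1; case: (ltrgt0P c); case: (ltrgt0P (c + 1)); lra.
Qed.

Lemma long_edge_segment v z l a c : long_edge N v z l -> bd N a = z -> bd N c = z + l *: v ->
  forall s : R, 0 <= s <= 1 -> N (bd N a + s *: (bd N c - bd N a)) = 1.
Proof.
move=> vzl -> -> s s01; rewrite addrAC subrr add0r scalerA.
apply: (long_edge_unit vzl); have [_ l1 _ _ _] := vzl.
by rewrite mulr_ge0 ?ler_piMl //; lra.
Qed.

Lemma bd_order c a b : c < a < c + pi -> c < b < c + pi ->
  0 < det2 (bd N a) (bd N b) -> a < b.
Proof.
move=> ca cb d0; rewrite ltNge le_eqVlt; apply/negP => /predU1P[e|ba].
  by move: d0; rewrite e det2vv ltxx.
have : 0 < det2 (bd N b) (bd N a) by apply: det2_bd_gt0; lra.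
rewrite det2C; lra.
Qed.

(** The bounds on [m] are strict: near [x] the unit circle is straight on both sides of [x], which
    [bad_bumps] exploits. *)
Definition on_edge v z l x := exists2 m : R, 0 < m < l & x = z + m *: v \/ x = - (z + m *: v).

Lemma on_edge_rev v z l x : on_edge (- v) (z + l *: v) l x -> on_edge v z l x.
Proof.
move=> [m m0 h]; exists (l - m); first by lra.
have e : z + l *: v + m *: - v = z + (l - m) *: v by vec.
by rewrite -e.
Qed.

Lemma on_edge_opp v z l x : on_edge (- v) (- z) l x -> on_edge v z l x.
Proof.
move=> [m m0 h]; exists m => //.
have e : - z + m *: - v = - (z + m *: v) by vec.
by move: h; rewrite e opprK => -[]; [right|left].
Qed.

Lemma long_edge_opp v z l : long_edge N v z l -> long_edge N (- v) (- z) l.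
Proof.
by move=> [v1 l1 z1 zv1 zl1]; split; rewrite ?scalerN -?opprD ?nrmN.
Qed.

(* Between [bd a] and an endpoint of the edge parallel to it, chords have length
   at most 1; so a second long edge must pass through [bd a] or its antipode. *)
Lemma cross_oriented a z l w y m g : long_edge N (bd N a) z l -> 0 < det2 (bd N a) z ->
  long_edge N w y m -> 0 < det2 y w -> a <= g < a + pi -> y = bd N g ->
  det2 (bd N a) w != 0 -> on_edge w y m (bd N a).
Proof.
move=> tzl dtz wym dyw ag yE dtw.
have [t1 l1 z1 zt1 ztl1] := tzl; have [w1 m1 y1 yw1 ywm1] := wym.
have [f1 af1 f1E] := unit_bd_gt0 z1 dtz.
have [|f0 af0 f0E] := @unit_bd_gt0 R N _ a ztl1.
  by rewrite det2Dr det2Zr det2vv mulr0 addr0.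
have f01 : f0 < f1.
  apply: (bd_order af0 af1); rewrite -f0E -f1E det2Dl det2vv det2Zl add0r.
  by apply: mulr_gt0 => //; lra.
have [|g1 gg1 g1E] := @unit_bd_gt0 R N _ g ywm1.
  rewrite -yE det2Dr det2vv add0r det2Zr; apply: mulr_gt0 => //; lra.
have dg : dist N g g1 = m.
  rewrite /dist -yE -g1E opprD addNKr nrmN nrm_scale_ge0 ?w1 ?mulr1 //; lra.
have dl : dist N a f0 = 1.
  rewrite distC /dist -f0E.
  have -> : z + l *: bd N a - bd N a = z + (l - 1) *: bd N a by vec.
  by rewrite (long_edge_unit tzl) //; lra.
have dr : dist N f1 (a + pi) = 1.
  by rewrite /dist bdDpi opprK -f1E.
have seg : forall s : R, 0 <= s <= 1 -> N (bd N g + s *: (bd N g1 - bd N g)) = 1.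
  exact: (long_edge_segment wym (esym yE) (esym g1E)).
have segf : forall s : R, 0 <= s <= 1 -> N (bd N f0 + s *: (bd N f1 - bd N f0)) = 1.
  apply: (long_edge_segment (long_edge_rev tzl)); first by rewrite -f0E.
  by rewrite -f1E; vec.
(* If the edge runs past [a + pi], then [- bd N a] lies inside it, which is the claim. *)
have [g1pi|g1pi] := leP g1 (a + pi); last first.
  have [||s s01] := @bd_segment g (a + pi) g1 _ _ seg; [lra|lra|].
  rewrite bdDpi -yE -g1E addrAC subrr add0r scalerA => h.
  exists (s * m); first by apply/andP; split; [apply: mulr_gt0; lra|rewrite gtr_pMl; lra].
  by right; rewrite -h opprK.
have [h|f0g] := leP g1 f0.
  by have := @dist_nest R N a g g1 f0; rewrite dg dl; lra.
have [h|gf1] := leP f1 g.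
  by have := @dist_nest R N f1 g g1 (a + pi); rewrite dg dr; lra.
(* In the remaining case the two edges share the arc from [h0] to [h1]. Its chord would be parallel
   both to [w] and to [bd N a]. *)
pose h0 := Num.max g f0; pose h1 := Num.min g1 f1.
have h01 : h0 < h1.
  by rewrite /h0 /h1 gt_max !lt_min f0g gf1 f01; case/andP: gg1 => -> _.
have hg0 : g <= h0 by rewrite le_max lexx.
have hf0 : f0 <= h0 by rewrite le_max lexx orbT.
have hg1 : h1 <= g1 by rewrite ge_min lexx.
have hf1 : h1 <= f1 by rewrite ge_min lexx orbT.
have [||s0 s0E] := @bd_segment_le g h0 g1 _ _ seg; [lra|lra|].
have [||s1 s1E] := @bd_segment_le g h1 g1 _ _ seg; [lra|lra|].
have [||r0 r0E] := @bd_segment_le f0 h0 f1 _ _ segf; [lra|lra|].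
have [||r1 r1E] := @bd_segment_le f0 h1 f1 _ _ segf; [lra|lra|].
have hw : bd N h1 - bd N h0 = ((s1 - s0) * m) *: w.
  by rewrite s1E s0E -yE -g1E; vec.
have ht : bd N h1 - bd N h0 = ((r0 - r1) * l) *: bd N a.
  by rewrite r1E r0E -f0E -f1E; vec.
have [e|ne] := eqVneq ((s1 - s0) * m) 0.
  move: hw; rewrite e scale0r => /eqP; rewrite subr_eq0 => /eqP h.
  have hh : h0 = h1 by apply: (@bd_inj R N) => //; lra.
  by rewrite hh ltxx in h01.
have : det2 (bd N a) (bd N h1 - bd N h0) = 0 by rewrite ht det2Zr det2vv mulr0.
by rewrite hw det2Zr => /eqP; rewrite mulf_eq0 (negPf ne) (negPf dtw).
Qed.

(** Symmetry reduces to [cross_oriented]: pass to the antipodal edge for [t], reverse the edge of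
    [w], and apply a half turn to it if it starts in the wrong half. *)
Lemma cross t z l w y m : long_edge N t z l -> long_edge N w y m ->
  det2 t w != 0 -> on_edge w y m t.
Proof.
move=> tzl wym dtw; have t1 : N t = 1 by case: tzl.
have [a _ tE] := @unit_bd R N t 0 t1; rewrite {t t1}tE in tzl dtw *.
wlog dtz : z tzl / 0 < det2 (bd N a) z.
  move=> H; have dz := long_edge_det tzl.
  have [/(H _ tzl)//|d0] := ltP 0 (det2 (bd N a) z).
  apply: (H _ (long_edgeN tzl)).
  by rewrite det2Dr !det2Nr det2Zr det2vv mulr0 subr0 oppr_gt0 lt_neqAle dz.
wlog dyw : w y wym dtw / 0 < det2 y w.
  move=> H; have dz := long_edge_det wym.
  have [/(H _ _ wym dtw)//|d0] := ltP 0 (det2 y w).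
  apply/on_edge_rev/H; first exact: long_edge_rev.
    by rewrite det2Nr oppr_eq0.
  rewrite det2Nr det2Dl det2Zl det2vv mulr0 addr0 oppr_gt0 lt_neqAle d0 andbT.
  by rewrite -oppr_eq0 -det2C.
have y1 : N y = 1 by case: wym.
have [g ag yE] := @unit_bd R N y a y1.
have [gp|gp] := ltP g (a + pi).
  by apply: (cross_oriented tzl dtz wym dyw _ yE dtw); lra.
apply: on_edge_opp; apply: (@cross_oriented a z l _ _ _ (g - pi) tzl dtz).
- exact: long_edge_opp.
- by rewrite det2Nl det2Nr opprK.
- lra.
- by rewrite yE bdBpi.
- by rewrite det2Nr oppr_eq0.
Qed.

Lemma bad_bumps t w : bad N t -> bad N w -> det2 t w != 0 ->
  exists e, [/\ 0 < e, N (t + e *: w) <= 1 & N (t - e *: w) <= 1].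
Proof.
move=> [z [l tzl]] [y [m wym]] dtw; have [k k0 tE] := cross tzl wym dtw.
pose e := Num.min k (m - k).
have e0 : 0 < e by rewrite lt_min; lra.
have ek : e <= k by rewrite ge_min lexx.
have em : e <= m - k by rewrite ge_min lexx orbT.
exists e; split => //; case: tE => ->.
- have -> : y + k *: w + e *: w = y + (k + e) *: w by vec.
  by rewrite (long_edge_unit wym) //; lra.
- have -> : - (y + k *: w) + e *: w = - (y + (k - e) *: w) by vec.
  by rewrite nrmN (long_edge_unit wym) //; lra.
- have -> : y + k *: w - e *: w = y + (k - e) *: w by vec.
  by rewrite (long_edge_unit wym) //; lra.
- have -> : - (y + k *: w) - e *: w = - (y + (k + e) *: w) by vec.
  by rewrite nrmN (long_edge_unit wym) //; lra.
Qed.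

(** The line through [t] parallel to [w] meets the unit ball in a segment around [t], so it supports
    the ball; this bounds the coordinate along [t]. *)
Lemma bump_support t w e a b : N t = 1 -> 0 < e -> N (t + e *: w) <= 1 ->
  N (t - e *: w) <= 1 -> `|a| <= N (a *: t + b *: w).
Proof.
move=> t1 e0.
wlog a0 : a b / 0 <= a.
  move=> H hp hm; have [a0|a0] := leP 0 a; first exact: H.
  rewrite -normrN; have -> : a *: t + b *: w = - ((- a) *: t + (- b) *: w) by vec.
  by rewrite nrmN; apply: H => //; lra.
rewrite ger0_norm //.
wlog b0 : b w / 0 <= b.
  move=> H hp hm; have [b0|b0] := leP 0 b; first exact: H.
  have -> : b *: w = (- b) *: - w by vec.
  by apply: H; rewrite ?scalerN ?opprK //; lra.
move=> _ hm.
have be : 0 <= b / e by rewrite divr_ge0 // ltW.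
have := nrm_comb N (a *: t + b *: w) (t - e *: w) ler01 be.
have -> : 1 *: (a *: t + b *: w) + (b / e) *: (t - e *: w) = (a + b / e) *: t.
  by apply/rowP => i; rewrite !mxE; field; rewrite gt_eqF.
rewrite nrm_scale_ge0 ?t1; last by rewrite addr_ge0.
have := ler_wpM2l be hm; lra.
Qed.

Lemma bad_support t w a b : bad N t -> bad N w -> det2 t w != 0 ->
  `|a| <= N (a *: t + b *: w).
Proof.
move=> bt bw dtw; have [e [e0 hp hm]] := bad_bumps bt bw dtw.
by apply: (bump_support _ _ _ e0) => //; case: bt => ? [? []].
Qed.

(** If [v] is not parallel to [t], both [t + e *: v] and [t - e *: v] lie in the unit ball. Their
    coordinates [1 + e * a] and [1 - e * a] along [t] are at most 1 by [bad_support], so [a = 0] and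
    [v] is parallel to [w]. *)
Lemma bad_le2 t w v : bad N t -> bad N w -> bad N v -> det2 t w != 0 ->
  det2 t v = 0 \/ det2 w v = 0.
Proof.
move=> bt bw bv dtw; have [|dtv] := eqVneq (det2 t v) 0; first by left.
right; have [e [e0 hp hm]] := bad_bumps bt bv dtv.
move: hp hm; rewrite (cramer_div v dtw).
set a := _ / _; set b := _ / _ => hp hm.
have := @bad_support t w (1 + e * a) (e * b) bt bw dtw.
have -> : (1 + e * a) *: t + (e * b) *: w = t + e *: (a *: t + b *: w) by vec.
move=> /le_trans/(_ hp) h1.
have := @bad_support t w (1 - e * a) (- (e * b)) bt bw dtw.
have -> : (1 - e * a) *: t + (- (e * b)) *: w = t - e *: (a *: t + b *: w) by vec.
move=> /le_trans/(_ hm) h2.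
have ea0 : e * a = 0 by move: h1 h2; rewrite !ler_norml; lra.
have a0 : a = 0 by apply/eqP; move/eqP: ea0; rewrite mulf_eq0 gt_eqF.
by rewrite a0 scale0r add0r det2Zr det2vv mulr0.
Qed.

Lemma unit_parallel t v : N t = 1 -> N v = 1 -> det2 t v = 0 -> v = t \/ v = - t.
Proof.
move=> t1 v1 /det2_eq0/(_ (unit_neq0 t1))[c vE].
have c1 : `|c| = 1 by rewrite -[RHS]v1 vE nrm_scale t1 mulr1.
rewrite vE; have [c0|c0] := leP 0 c.
  by left; rewrite -(ger0_norm c0) c1 scale1r.
by right; rewrite -[c]opprK -(ltr0_norm c0) c1 scaleN1r.
Qed.

Lemma bad_unit v : bad N v -> N v = 1. Proof. by case=> ? [? []]. Qed.

(* [N] is the maximum norm with respect to some basis. *)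
Definition square := exists t w, [/\ N t = 1, N w = 1, N (t + w) <= 1 & N (t - w) <= 1].

(** A unit vector at distance 1 from [v] lies on the line of the edge parallel to [v] or on its
    reflection. By [cross] these lines pass through [w] and [- w], so its coordinate along [w] is 1
    or -1. *)
Lemma two_bad_off v w a b : bad N v -> bad N w -> det2 v w != 0 -> `|b| < 1 ->
  N (a *: v + b *: w) = 1 -> N (a *: v + b *: w - v) <> 1.
Proof.
move=> bv bw dvw b1 s1 sv1; have [z [l vzl]] := bv; have [y [m wym]] := bw.
have dwv : det2 w v != 0 by rewrite det2C oppr_eq0.
have [k k0 wE] := cross wym vzl dwv.
have line := long_edge_line vzl s1 sv1.
have [h|h] : b = 1 \/ b = -1; last 2 first.
- by move: b1; rewrite h normr1 ltxx.
- by move: b1; rewrite h normrN normr1 ltxx.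
case: wE => wE.
  by apply: (line (a + b * k)); rewrite wE; vec.
have [|h|h] := line (a - b * k) (- b); first by rewrite wE; vec.
- by right; rewrite -h opprK.
- by left; apply: oppr_inj.
Qed.

(** A starting vertex for a hexagon without bad vertices: up to sign its other two vertices are at
    distance 1 from [s] or from [- s]. *)
Definition good s := [/\ N s = 1, ~ bad N s & forall v, bad N v -> N (s - v) <> 1].

(** After division by [n > 1] both coordinates of [t + w] are below 1, so [two_bad_off] excludes
    each of the four bad vectors. *)
Lemma good_two_bad t w : bad N t -> bad N w -> det2 t w != 0 -> 1 < N (t + w) ->
  exists s, good s.
Proof.
move=> bt bw dtw n1; pose n := N (t + w).
have n0 : 0 < n by rewrite (lt_trans _ n1).
have sE : n^-1 *: (t + w) = n^-1 *: t + n^-1 *: w by rewrite scalerDr.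
have s1 : N (n^-1 *: (t + w)) = 1.
  by rewrite nrm_scale_ge0 ?invr_ge0 ?(ltW n0) // mulVf // gt_eqF.
have ni : `|n^-1| < 1 by rewrite gtr0_norm ?invr_gt0 // invf_lt1.
have dwt : det2 w t != 0 by rewrite det2C oppr_eq0.
have nN0 : n^-1 != 0 by rewrite invr_eq0 gt_eqF.
have par v : bad N v -> [\/ v = t, v = - t, v = w | v = - w].
  move=> bv; case: (bad_le2 bt bw bv dtw) => /unit_parallel [];
    rewrite ?bad_unit // => ->; by [constructor 1|constructor 2|constructor 3|constructor 4].
exists (n^-1 *: (t + w)); split => //.
  move=> /(bad_le2 bt bw)/(_ dtw); rewrite !det2Zr !det2Dr !det2vv addr0 add0r.
  by case=> /eqP; rewrite mulf_eq0 (negPf nN0) ?(negPf dtw) ?(negPf dwt).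
move=> v /par[] ->; rewrite sE; rewrite sE in s1.
- exact: two_bad_off.
- have -> : n^-1 *: t + n^-1 *: w = (- n^-1) *: - t + n^-1 *: w by vec.
  apply: two_bad_off => //; first exact: badN.
    by rewrite det2Nl oppr_eq0.
  by rewrite scalerN scaleNr opprK.
- rewrite (addrC (_ *: t)) in s1 *; exact: two_bad_off.
- have -> : n^-1 *: t + n^-1 *: w = (- n^-1) *: - w + n^-1 *: t by vec.
  apply: two_bad_off => //; first exact: badN.
    by rewrite det2Nl oppr_eq0.
  by rewrite scalerN scaleNr opprK addrC.
Qed.

Lemma good_one_bad t z l : long_edge N t z l -> (forall v, bad N v -> det2 t v = 0) ->
  exists s, good s.
Proof.
(* The factor 3 makes [n] at least 2. The normalised vector then has coordinate at most 1/2 along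
   [z], off the two lines with coordinate 1 and -1. *)
move=> tzl par; have [t1 l1 z1 zt1 zl1] := tzl; pose n := N (z + 3 *: t).
have n2 : 2 <= n.
  have := nrm_add N (z + 3 *: t) (- z); rewrite addrAC subrr add0r nrmN z1.
  by rewrite nrm_scale_ge0 ?t1 // /n; lra.
have n0 : 0 < n by lra.
have nN0 : n^-1 != 0 by rewrite invr_eq0 gt_eqF.
have ni : n^-1 <= 2^-1 by rewrite lef_pV2 ?posrE.
have ni0 : 0 < n^-1 by rewrite invr_gt0.
have dtz := long_edge_det tzl.
have s1 : N (n^-1 *: (z + 3 *: t)) = 1.
  by rewrite nrm_scale_ge0 ?invr_ge0 ?(ltW n0) // mulVf // gt_eqF.
exists (n^-1 *: (z + 3 *: t)); split => //.
  move=> /par; rewrite det2Zr det2Dr det2Zr det2vv mulr0 addr0 => /eqP.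
  by rewrite mulf_eq0 (negPf nN0) (negPf dtz).
move=> v bv sv; case: (unit_parallel t1 (bad_unit bv) (par _ bv)) => vE; rewrite vE in sv.
  by have [|h|h] := long_edge_line tzl s1 sv (a := n^-1 * 3) (b := n^-1); [vec|lra|lra].
have := long_edge_line (long_edge_rev tzl) s1 sv (a := - (n^-1 * 3) + n^-1 * l) (b := n^-1).
by case=> [|h|h]; [vec|lra|lra].
Qed.

(** With two independent bad directions [t] and [w], the candidates are the normalised [t + w] and
    [t - w]. They fail together only if both sums lie in the unit ball, and then the norm is a
    maximum norm. *)
Lemma exists_good : ~ square -> exists s, good s.
Proof.
move=> nsq.
have [[t bt]|nobad] := pselect (exists t, bad N t); last first.
  exists (bd N 0); split; first exact: bd_unit.
    by move=> h; apply: nobad; exists (bd N 0).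
  by move=> v bv; case: nobad; exists v.
have [[w [bw dtw]]|par] := pselect (exists w, bad N w /\ det2 t w != 0); last first.
  have [z [l tzl]] := bt; apply: (good_one_bad tzl) => v bv.
  by apply/eqP; apply: contrapT => /negP dv; apply: par; exists v.
have [n1|n1] := ltP 1 (N (t + w)); first exact: (good_two_bad bt bw).
have [n2|n2] := ltP 1 (N (t - w)).
  by apply: (good_two_bad bt (badN bw)) => //; rewrite det2Nr oppr_eq0.
by case: nsq; exists t, w; split => //; exact: bad_unit.
Qed.

Lemma bad_hexagon v s : bad N v -> N s = 1 -> N (v - s) = 1 -> ~ good s.
Proof. by move=> bv s1; rewrite nrmB => h [_ _ /(_ _ bv)]. Qed.

Lemma goodN s : good s -> good (- s).
Proof.
move=> [s1 sb h]; split; first by rewrite nrmN.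
  by move=> /badN; rewrite opprK.
move=> v /badN bv; rewrite -opprD nrmN; have := h _ bv; by rewrite opprK.
Qed.

Lemma exists_good_hexagon : ~ square -> exists a0 a1 a2,
  [/\ a0 < a1 < a2, a2 < a0 + pi,
      [/\ dist N a0 a1 = 1, dist N a1 a2 = 1 & dist N a2 (a0 + pi) = 1] &
      [/\ ~ bad N (bd N a0), ~ bad N (bd N a1) & ~ bad N (bd N a2)]].
Proof.
move=> /exists_good[s gs]; have [s1 sb sv] := gs.
have [a0 _ sE] := unit_bd 0 s1; rewrite {}sE in gs s1 sb sv.
have pi0 := @pi_gt0 R.
have [||a1 a01 d01] := @dist_ivt R N a0 (a0 + pi); [lra|by rewrite distDpi; lra|].
have a1pi : a1 < a0 + pi.
  rewrite lt_neqAle; case/andP: a01 => _ ->; rewrite andbT.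
  by apply/eqP => h; move: d01; rewrite h distDpi; lra.
have [|a2 a12 a2E] := hexagon _ d01; first by lra.
exists a0, a1, a2; split => //; try lra.
- split => //.
    by rewrite /dist a2E opprB addrCA subrr addr0 bd_unit.
  by rewrite /dist a2E bdDpi opprK subrK bd_unit.
- split => //.
    by move=> b1; apply: (bad_hexagon b1 s1) => //; rewrite -/(dist N a1 a0) distC.
  move=> b2; apply: (bad_hexagon b2 _ _ (goodN gs)); first by rewrite nrmN.
  by rewrite a2E opprK subrK bd_unit.
Qed.
End long_edges.

(** * Upper bounds *)

Section upper_bounds.
Context {R : realType}.
Local Notation plane := 'rV[R]_2.
Variable N : plane_norm R.
Implicit Types (x z v w t : plane) (a b c y : R).

(* The vectors of a minimal family in counterclockwise order, the angles being
   lifted to an increasing sequence that gains a full turn every [n] steps. *)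
Definition cyc_seq (P : R -> Prop) (n : nat) (u : nat -> R) :=
  [/\ forall i, u i < u i.+1, forall i, u (i + n)%N = u i + 2 * pi,
      forall i, u i.+2 <= u i + pi,
      forall i, P (dist N (u i) (u i.+1)) & forall i, ~ P (dist N (u i) (u i.+2))].

(** The order part of [cyc_seq] alone, so that indices can be lifted before the metric conditions of
    a family are established. *)
Definition turn n (u : nat -> R) :=
  (forall i, u i < u i.+1) /\ forall i, u (i + n)%N = u i + 2 * pi.

Lemma cyc_turn P n u : cyc_seq P n u -> turn n u.
Proof. by case. Qed.

Lemma turn_lt n u : turn n u -> forall i j, (i < j)%N -> u i < u j.
Proof. by move=> [inc _] i j; apply: (homo_ltn lt_trans inc). Qed.

Lemma turn_le n u : turn n u -> forall i j, (i <= j)%N -> u i <= u j.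
Proof.
move=> h i j; rewrite leq_eqVlt => /predU1P[->//|/(turn_lt h)]; exact: ltW.
Qed.

Lemma turn_ltE n u : turn n u -> forall i j, u i < u j -> (i < j)%N.
Proof.
move=> h i j ij; rewrite ltnNge; apply/negP => /(turn_le h); lra.
Qed.

Lemma cyc_lt P n u : cyc_seq P n u -> forall i j, (i < j)%N -> u i < u j.
Proof. by move=> /cyc_turn/turn_lt. Qed.

Lemma cyc_le P n u : cyc_seq P n u -> forall i j, (i <= j)%N -> u i <= u j.
Proof. by move=> /cyc_turn/turn_le. Qed.

Lemma cyc_ltE P n u : cyc_seq P n u -> forall i j, u i < u j -> (i < j)%N.
Proof. by move=> /cyc_turn/turn_ltE. Qed.

(** Otherwise the hexagon angles [a], [q], [r], [a + pi] divide the half turn into arcs with unit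
    chords, where [q <= b]. Either the arc from [b] to [c] lies between [q] and [r], or the one from
    [c] to [e] lies between [r] and [a + pi]. *)
Lemma three_long_steps a b c e : a < b < c -> c < e ->
  1 < dist N a b -> 1 < dist N b c -> 1 < dist N c e -> a + pi < e.
Proof.
move=> abc ce dab dbc dce; rewrite ltNge; apply/negP => ea.
have [||q aq dq] := @dist_ivt R N a b; [lra|lra|].
have [|r qr rE] := hexagon _ dq; first by lra.
have dqr : dist N q r = 1.
  by rewrite /dist rE opprB addrCA subrr addr0 bd_unit.
have dra : dist N r (a + pi) = 1.
  by rewrite /dist rE bdDpi opprK subrK bd_unit.
have [cr|rc] := leP c r.
  by have := @dist_nest R N q b c r; rewrite dqr; lra.
by have := @dist_nest R N r c e (a + pi); rewrite dra; lra.
Qed.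

Lemma cyc_seq_le11 n u : cyc_seq (fun d => d <= 1) n u -> (n <= 11)%N.
Proof.
move=> h; have [inc per _ _ far] := h.
have far' i : 1 < dist N (u i) (u i.+2) by rewrite ltNge; apply/negP/far.
have half i : u i + pi < u i.+2.+2.+2.
  apply: (three_long_steps _ _ (far' i) (far' i.+2) (far' i.+2.+2)).
    by rewrite !(cyc_lt h).
  by rewrite (cyc_lt h).
rewrite leqNgt; apply/negP => n12.
have := cyc_le h n12; have := half 0%N; have := half 6%N; have := per 0%N.
rewrite add0n; lra.
Qed.

(** [a] and [b] are the directions of the midpoints of two adjacent sides; the window for [a] can
    start at any prescribed angle. *)
Lemma square_angles : square N -> forall c, exists a b,
  [/\ c <= a < c + 2 * pi, a < b < a + pi, dist N a b <= 1 & dist N b (a + pi) <= 1].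
Proof.
move=> [t [w [t1 w1 pw mw]]] c.
wlog d0 : w w1 pw mw / 0 < det2 t w.
  move=> H; have [d0|d0] := ltP 0 (det2 t w); first exact: (H w).
  apply: (H (- w)); rewrite ?nrmN ?opprK // det2Nr oppr_gt0 lt_neqAle d0 andbT.
  apply/eqP => /(unit_parallel t1 w1)[] wE; move: pw mw; rewrite wE.
    by rewrite -mulr2n -scaler_nat nrm_scale_ge0 ?t1 //; lra.
  by rewrite opprK -mulr2n -scaler_nat nrm_scale_ge0 ?t1 //; lra.
have [a ca aE] := unit_bd c t1; rewrite aE in d0.
have [b ab bE] := unit_bd_gt0 w1 d0.
exists a, b; split => //; first by rewrite /dist -aE -bE.
by rewrite /dist bdDpi opprK -aE -bE addrC.
Qed.

Lemma cyc_seq_le8 n u : square N -> cyc_seq (fun d => d <= 1) n u -> (n <= 8)%N.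
Proof.
move=> sq h; have [inc per _ _ far] := h.
have [a [b [ua ab dab dba]]] := square_angles sq (u 0%N).
have far' i j k : (j = i.+2)%N -> (k = i)%N -> 1 < dist N (u k) (u j).
  by move=> -> ->; rewrite ltNge; apply/negP/far.
have exk : exists k, a <= u k by exists n; have := per 0%N; rewrite add0n; lra.
(* [k] is the first index not before the midpoint [a]. Four double steps from it pass [a + 2 * pi];
   with [n >= 9] they stay within a turn of [u k.-1], which lies before [a]. If [k = 0], then
   [k.-1 = 0] and [u 0 = a], which still suffices. *)
case: (ex_minnP exk) => k ak kmin.
rewrite leqNgt; apply/negP => n9.
have lt1 : u k < u k.+2 by apply: (cyc_lt h).
have lt2 : u k.+2 < u k.+2.+2 by apply: (cyc_lt h).
have lt3 : u k.+4 < u k.+4.+2 by apply: (cyc_lt h).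
have lt4 : u k.+4.+2 < u k.+4.+4 by apply: (cyc_lt h).
have f1 := far' k _ _ erefl erefl; have f2 := far' k.+2 _ _ erefl erefl.
have f3 := far' k.+4 _ _ erefl erefl; have f4 := far' k.+4.+2 _ _ erefl erefl.
have s1 : b < u k.+2.
  rewrite ltNge; apply/negP => ub.
  by have := @dist_nest R N a (u k) (u k.+2) b; lra.
have s2 : a + pi < u k.+4.
  rewrite ltNge; apply/negP => ub.
  by have := @dist_nest R N b (u k.+2) (u k.+4) (a + pi); lra.
have dab' : dist N (a + pi) (b + pi) <= 1 by rewrite dist_pi2.
have dba' : dist N (b + pi) (a + pi + pi) <= 1 by rewrite dist_pi2.
have s3 : b + pi < u k.+4.+2.
  rewrite ltNge; apply/negP => ub.
  by have := @dist_nest R N (a + pi) (u k.+4) (u k.+4.+2) (b + pi); lra.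
have s4 : a + pi + pi < u k.+4.+4.
  rewrite ltNge; apply/negP => ub.
  by have := @dist_nest R N (b + pi) (u k.+4.+2) (u k.+4.+4) (a + pi + pi); lra.
have : u k.+4.+4 <= u (k.-1 + n)%N.
  apply: (cyc_le h); case: k {ak kmin lt1 lt2 lt3 lt4 f1 f2 f3 f4 s1 s2 s3 s4} => [|k] /=.
    by rewrite add0n ltnW.
  have -> : k.+4.+4 = (k + 8)%N by rewrite !addnS addn0.
  by rewrite ltn_add2l.
rewrite per; case: k kmin ak {lt1 lt2 lt3 lt4 f1 f2 f3 f4 s1 s2 s3} s4 => [|k] kmin ak s4 /=; first by lra.
suff : u k < a by lra.
by rewrite ltNge; apply/negP => /kmin; rewrite ltnn.
Qed.

Section cyclic.
Variables (n : nat) (u : nat -> R).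
Hypothesis uT : turn n u.

Let lt_u := turn_lt uT.

Lemma turn_per i : u (i + n)%N = u i + 2 * pi. Proof. by case: uT. Qed.
Lemma turn_n_gt0 : (0 < n)%N.
Proof.
rewrite lt0n; apply/eqP => n0; have := turn_per 0; rewrite n0 addn0.
have := @pi_gt0 R; lra.
Qed.

Lemma turn_per_mul i k : u (i + k * n)%N = u i + k%:R * (2 * pi).
Proof.
elim: k => [|k IH]; first by rewrite mul0n addn0 mul0r addr0.
by rewrite mulSn addnCA addnC turn_per IH -natr1; ring.
Qed.

Lemma bd_per_mul i k : bd N (u (i + k * n)) = bd N (u i).
Proof.
elim: k => [|k IH]; first by rewrite mul0n addn0.
by rewrite mulSn addnCA addnC turn_per bdD2pi IH.
Qed.

Lemma bd_mod i : bd N (u (i %% n)) = bd N (u i).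
Proof. by rewrite [in RHS](divn_eq i n) addnC bd_per_mul. Qed.

Lemma bd_mod_inj i j : (i < n)%N -> (j < n)%N -> bd N (u i) = bd N (u j) -> i = j.
Proof.
wlog ij : i j / (i <= j)%N.
  move=> H i0 j0 e; have [ij|ij] := leqP i j; first exact: H.
  by apply/esym/H => //; exact: ltnW.
move=> i0 j0 /(bd_inj) e; move: ij; rewrite leq_eqVlt => /predU1P[//|ij].
have uij := lt_u ij.
have : u j < u i + 2 * pi by rewrite -turn_per lt_u // (leq_trans j0) // leq_addl.
move=> uj; have := e; rewrite (ltW uij) uj => /(_ isT) h.
by rewrite h ltxx in uij.
Qed.

Lemma lift_index i k : exists j, [/\ (k <= j)%N, (j < k + n)%N & bd N (u j) = bd N (u i)].
Proof.
(* [n - k %% n] represents [- k] modulo [n]. *)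
have n0 := turn_n_gt0; exists (k + (i + (n - k %% n)) %% n)%N; split.
- exact: leq_addr.
- by rewrite ltn_add2l ltn_mod.
rewrite -[LHS]bd_mod -[RHS]bd_mod; congr (bd N (u _)).
have e : ((k + (n - k %% n)) %% n = 0)%N.
  by rewrite -modnDml subnKC ?modnn // ltnW ?ltn_mod.
by rewrite modnDmr addnCA -modnDmr e addn0.
Qed.

Lemma lift_angle k b i : u k <= b < u k + 2 * pi -> bd N b = bd N (u i) ->
  exists2 j, (k <= j)%N & u j = b.
Proof.
move=> kb bi; have [j [kj jn jE]] := lift_index i k.
exists j => //; have kuj := turn_le uT kj.
have ujn : u j < u k + 2 * pi by rewrite -turn_per lt_u.
have e : bd N (u j) = bd N b by rewrite jE bi.
have [h|h] := leP (u j) b; first by apply: (bd_inj _ e); lra.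
by apply/esym/(bd_inj _ (esym e)); lra.
Qed.
End cyclic.

(** * The strict case: active points and quarter turns *)

Section strict.
Variables (n : nat) (u : nat -> R).
Hypothesis uP : cyc_seq (fun d => d < 1) n u.

Let lt_u := cyc_lt uP.
Let uT := cyc_turn uP.


Lemma cyc_gap i : u i.+2 <= u i + pi. Proof. by case: uP. Qed.
Lemma cyc_far i : 1 <= dist N (u i) (u i.+2).
Proof. by rewrite leNgt; apply/negP; case: uP. Qed.

Definition short i := u i.+2.+2.+2 < u i + pi.

(* The double step from [u j] is not the longest one of length 1. *)
Definition active j := exists2 y, u j.+2 < y < u j + pi & dist N (u j) y = 1.

Lemma short_mod i : short (i %% n) <-> short i.
Proof.
rewrite /short [X in _ <-> u X.+2.+2.+2 < u X + _](divn_eq i n) ![(_ * n + _)%N]addnC.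
by rewrite -!addSn !(turn_per_mul uT); split; lra.
Qed.

Lemma active_mod i : active (i %% n) <-> active i.
Proof.
rewrite /active [X in _ <-> exists2 y, u X.+2 < y < u X + _ & dist N (u X) _ = _](divn_eq i n).
rewrite ![(_ * n + _)%N]addnC -!addSn !(turn_per_mul uT).
have dE (c y : R) : dist N (c + (i %/ n)%:R * (2 * pi)) (y + (i %/ n)%:R * (2 * pi)) = dist N c y.
  elim: (i %/ n)%N => [|k IH]; first by rewrite mul0r !addr0.
  by rewrite -natr1 mulrDl mul1r !addrA dist_2pi IH.
split=> -[y yi dy].
  by exists (y + (i %/ n)%:R * (2 * pi)); [lra|rewrite dE].
exists (y - (i %/ n)%:R * (2 * pi)); first lra.
by rewrite -dE subrK.
Qed.

Lemma active_dist j y : u j.+2 < y < u j + pi -> dist N (u j) y = 1 ->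
  dist N (u j) (u j.+2) = 1.
Proof.
move=> uy dy; apply/eqP; rewrite eq_le cyc_far andbT -dy.
have : u j < u j.+2 by apply: lt_u.
by move=> ?; apply: dist_mono_r; lra.
Qed.

(** Both [u j.+2] and the witness [y] are at distance 1 from [u j], so [flat_r] applies; the edge it
    gives ends at [bd N (u j.+2)], a position that [active_step] uses. *)
Lemma active_edge j : active j -> exists z (l m : R),
  [/\ long_edge N (bd N (u j)) z l, 0 < m & bd N (u j.+2) = z + (1 + m) *: bd N (u j) /\ l = 1 + m]
  /\ 0 < det2 (bd N (u j)) z.
Proof.
move=> [y uy dy]; have d2 := active_dist uy dy.
have ltu : u j < u j.+2 by apply: lt_u.
have [||al [al0 bE le]] := @flat_r R N (u j) (u j.+2) y _ _ d2 dy; [lra|lra|].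
exists (bd N y - bd N (u j)), (1 + al), al; split; first split => //.
  by split => //; rewrite bE; vec.
by rewrite det2Dr det2Nr det2vv subr0; apply: det2_bd_gt0; lra.
Qed.

Lemma active_bad j : active j -> bad N (bd N (u j)).
Proof. by move=> /active_edge[z [l [m [[le _ _] _]]]]; exists z, l. Qed.

(** The comparison of [three_long_steps] with equality allowed. Let [r] be the hexagon vertex before
    [u i + pi]. If [r <= u i.+4], then [u i + pi] is a later point at distance 1 from [u i.+4];
    otherwise [r] is one for [u i.+2]. *)
Lemma short_active i : short i -> active i.+2 \/ active i.+2.+2.
Proof.
rewrite /short => s6; have f0 := cyc_far i; have f2 := cyc_far i.+2; have f4 := cyc_far i.+2.+2.
have u02 : u i < u i.+2 by apply: lt_u.
have u24 : u i.+2 < u i.+2.+2 by apply: lt_u.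
have u46 : u i.+2.+2 < u i.+2.+2.+2 by apply: lt_u.
have [||q aq dq] := @dist_ivt R N (u i) (u i.+2); [lra|lra|].
have [|r qr rE] := hexagon _ dq; first by lra.
have dqr : dist N q r = 1.
  by rewrite /dist rE opprB addrCA subrr addr0 bd_unit.
have dra : dist N r (u i + pi) = 1.
  by rewrite /dist rE bdDpi opprK subrK bd_unit.
have [r4|r4] := leP r (u i.+2.+2).
  right; exists (u i + pi); first by lra.
  apply/eqP; rewrite eq_le; apply/andP; split.
    by rewrite -dra dist_mono_l //; lra.
  by apply: le_trans f4 _; rewrite dist_mono_r //; lra.
left; exists r; first by lra.
apply/eqP; rewrite eq_le; apply/andP; split.
  by rewrite -dqr dist_mono_l //; lra.
by apply: le_trans f2 _; rewrite dist_mono_r //; lra.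
Qed.

Lemma next_index k x : 0 < det2 (bd N (u k)) x -> (exists i, bd N (u i) = x) ->
  exists j, [/\ (k < j)%N, u k < u j < u k + pi & bd N (u j) = x].
Proof.
move=> d0 [i xE]; have [j [kj jn jE]] := (lift_index uT) i k.
rewrite -xE -jE in d0 *.
have uj : u k < u j < u k + pi.
  apply: bd_det2_gt0 d0; rewrite (cyc_le uP kj) /=.
  by rewrite -(turn_per uT) lt_u.
exists j; split => //; apply: (cyc_ltE uP); lra.
Qed.

(** Activity is demanded at every index of [x], so that it is available at whichever lift a later
    step produces. *)
Definition occurs_active x := (exists i, bd N (u i) = x) /\ forall i, bd N (u i) = x -> active i.

(** By [cross], [w] lies inside the edge parallel to [t] that ends at [bd N (u k.+2)], hence
    [x > 0]. The bound [x <= 1] is [bad_support]. *)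
Lemma active_step k t w : occurs_active w -> bd N (u k) = t -> active k ->
  0 < det2 t w -> exists x : R,
  [/\ 0 < x, x <= 1 & bd N (u k.+2) = w + x *: t].
Proof.
move=> [[i iE] iA] kE kA dtw; have bw : bad N w by rewrite -iE; exact: active_bad (iA _ iE).
have bt : bad N t by rewrite -kE; exact: active_bad.
have dwt : det2 w t != 0 by rewrite det2C oppr_eq0 gt_eqF.
have [z [l [m [[le m0 [k2 lE]] dz]]]] := active_edge kA.
rewrite kE in le k2 dz; have [c0 [d0 wcd]] := bw.
have [p p0 [wE|wE]] := cross wcd le dwt; last first.
  by move: dtw; rewrite wE det2Nr det2Dr det2Zr det2vv mulr0 addr0; lra.
have k2E : bd N (u k.+2) = w + (1 + m - p) *: t by rewrite k2 wE; vec.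
exists (1 + m - p); split => //; first by lra.
have dtwN : det2 t w != 0 by rewrite gt_eqF.
have := bad_support (1 + m - p) 1 bt bw dtwN.
rewrite scale1r (addrC _ w) -k2E bd_unit => h.
exact: le_trans (ler_norm _) h.
Qed.

(* A gap of four steps between the active points [t] and [w] would force
   [bd N (u k.+2) = t + w]; then [w + (b - 1) *: t], which lies on the edge through
   [w], brings [u k.+1] and [u k.+3] within distance less than 1. *)
Lemma quarter_turn k t w : occurs_active t -> occurs_active w -> occurs_active (- t) ->
  0 < det2 t w -> bd N (u k) = t ->
  exists j, [/\ (k < j <= k.+3)%N, u k < u j < u k + pi & bd N (u j) = w].
Proof.
move=> ot ow omt dtw kE; have [_ /(_ _ kE) kA] := ot; have [exw wA] := ow.
have [|j [kj ukj jE]] := @next_index k w _ exw; first by rewrite kE.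
exists j; split => //; rewrite kj /=; rewrite leqNgt; apply/negP => j4.
have jA := wA _ jE; have bt : bad N t by rewrite -kE; exact: active_bad.
have bw : bad N w by rewrite -jE; exact: active_bad.
have dtwN : det2 t w != 0 by rewrite gt_eqF.
have dwtN : det2 w t != 0 by rewrite det2C oppr_eq0.
have t1 := bad_unit bt; have w1 := bad_unit bw.
have [x [x0 x1 k2E]] := active_step ow kE kA dtw.
have u4j : u k.+4 <= u j by apply: (cyc_le uP).
have u01 : u k < u k.+1 by apply: lt_u.
have u12 : u k.+1 < u k.+2 by apply: lt_u.
have u23 : u k.+2 < u k.+3 by apply: lt_u.
have u34 : u k.+3 < u k.+4 by apply: lt_u.
(* The double step from [u k.+2] has length at least 1 and ends no later than [w], which is at
   distance [x] from [bd N (u k.+2)]. *)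
have xE : x = 1.
  apply/eqP; rewrite eq_le x1 /=; have := cyc_far k.+2.
  have : dist N (u k.+2) (u k.+4) <= dist N (u k.+2) (u j) by apply: dist_mono_r; lra.
  by rewrite [X in _ <= X]/dist k2E jE addrAC subrr add0r nrm_scale_ge0 ?t1 ?(ltW x0) //; lra.
rewrite xE scale1r in k2E.
have tw1 : N (t + w) = 1 by rewrite addrC -k2E bd_unit.
(* The unit circle contains the segments from [t + w] to [w] and to [t]; they place [u k.+3] and
   [u k.+1]. *)
have top a : 0 <= a <= 1 -> N (w + a *: t) = 1.
  move=> a01; apply/eqP; rewrite eq_le; apply/andP; split.
    have := nrm_comb N (t + w) w (_ : 0 <= a) (_ : 0 <= 1 - a).
    have -> : a *: (t + w) + (1 - a) *: w = w + a *: t by vec.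
    by rewrite tw1 w1 => H; have := H _ _; lra.
  by have := bad_support 1 a bw bt dwtN; rewrite scale1r normr1.
have right a : 0 <= a <= 1 -> N (t + a *: w) = 1.
  move=> a01; apply/eqP; rewrite eq_le; apply/andP; split.
    have := nrm_comb N (t + w) t (_ : 0 <= a) (_ : 0 <= 1 - a).
    have -> : a *: (t + w) + (1 - a) *: t = t + a *: w by vec.
    by rewrite tw1 t1 => H; have := H _ _; lra.
  by have := bad_support 1 a bt bw dtwN; rewrite scale1r normr1.
have [|||a a01 k1E] := @bd_segment R N (u k) (u k.+1) (u k.+2); [lra|lra| |].
  move=> s s01; rewrite kE k2E.
  by have -> : t + s *: (w + t - t) = t + s *: w; [vec|exact: right].
have seg s : 0 <= s <= 1 -> N (bd N (u k.+2) + s *: (bd N (u j) - bd N (u k.+2))) = 1.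
  move=> s01; rewrite k2E jE.
  by have -> : w + t + s *: (w - (w + t)) = w + (1 - s) *: t; [vec|apply: top; lra].
(* Otherwise [u k.+4] lies strictly inside the unit segment from [t + w] to [w], too close to
   [u k.+2]. *)
have jE4 : (j = k.+4)%N.
  apply/eqP; rewrite eqn_leq j4 andbT leqNgt; apply/negP => /lt_u u4j'.
  have [||s s01 k4E] := @bd_segment R N (u k.+2) (u k.+4) (u j) _ _ seg; [lra|lra|].
  have := cyc_far k.+2; rewrite /dist k4E opprD addNKr k2E jE nrmN.
  rewrite opprD addrA subrr add0r scalerN nrmN nrm_scale_ge0 ?t1; lra.
have [||b b01 k3E] := @bd_segment R N (u k.+2) (u k.+3) (u j) _ _ seg; [lra|lra|].
have [y [y0 y1 k6E]] : exists y : R, [/\ 0 < y, y <= 1 & bd N (u j.+2) = - t + y *: w].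
  by apply: active_step => //; rewrite det2Nr det2C opprK.
have [|l [jl ujl lE]] := @next_index j (- t) _ omt.1.
  by rewrite jE det2Nr det2C opprK.
have u45 : u j < u j.+1 by apply: lt_u.
have u56 : u j.+1 < u j.+2 by apply: lt_u.
have u67 : u j.+2 < u j.+3 by apply: lt_u.
have g46 := cyc_gap j.
have u6l : u j.+2 < u l.
  apply: (@bd_order _ N (u j)); [|lra|].
    rewrite (lt_trans u45) //= lt_neqAle g46 andbT; apply/eqP => e.
    have : det2 (bd N (u j)) (bd N (u j.+2)) = 0 by rewrite e bdDpi det2Nr det2vv oppr0.
    rewrite k6E jE det2Dr det2Nr det2Zr det2vv mulr0 addr0 det2C opprK => h.
    by rewrite h ltxx in dtw.
  rewrite k6E lE det2Dl det2Nl det2Nr det2vv opprK add0r det2Zl det2Nr (det2C t w) opprK.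
  exact: mulr_gt0.
have l7 : u j.+3 <= u l by apply: (cyc_le uP); exact: (cyc_ltE uP).
have [||p [q [p0 q0 k5E]]] := @bd_cone R N (u j) (u j.+1) (u l); [lra|lra|].
rewrite jE lE in k5E.
have q1 : q <= 1.
  have := bad_support (- q) p bt bw dtwN.
  have -> : - q *: t + p *: w = bd N (u j.+1) by rewrite k5E; vec.
  by rewrite bd_unit normrN ger0_norm // ltW.
have p1 : p <= 1.
  have := bad_support p (- q) bw bt dwtN.
  have -> : p *: w + - q *: t = bd N (u j.+1) by rewrite k5E; vec.
  by rewrite bd_unit ger0_norm // ltW.
have d5l : 1 <= dist N (u j.+1) (u l).
  by apply: le_trans (cyc_far j.+1) _; apply: dist_mono_r; lra.
(* Between [t] and [w] the norm is the maximum norm, so [p < 1] would put [u j.+1] at distance less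
   than 1 from [- t], which comes no earlier than [u j.+3]. *)
have pE : p = 1.
  apply/eqP; rewrite eq_le p1 /=; rewrite leNgt; apply/negP => plt.
  suff : dist N (u j.+1) (u l) < 1 by lra.
  have -> : dist N (u j.+1) (u l) = N (p *: w + (1 - q) *: t).
    by rewrite /dist k5E lE; congr (N _); vec.
  have [h|h] := leP p (1 - q).
    apply: (@le_lt_trans _ _ (1 - q)); last by lra.
    have := nrm_comb N (t + w) t (ltW p0) (_ : 0 <= 1 - q - p).
    have -> : p *: (t + w) + (1 - q - p) *: t = p *: w + (1 - q) *: t by vec.
    by rewrite tw1 t1 => H; have := H _; lra.
  apply: (@le_lt_trans _ _ p) => //.
  have := nrm_comb N (t + w) w (_ : 0 <= 1 - q) (_ : 0 <= p - (1 - q)).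
  have -> : (1 - q) *: (t + w) + (p - (1 - q)) *: w = p *: w + (1 - q) *: t by vec.
  by rewrite tw1 w1 => H; have := H _ _; lra.
(* The distance from [u k.+3] to [u j.+1] is [1 - b + q], so [b <= q]. Hence [w - b *: t] lies
   between [w] and [w - q *: t], in the unit ball, and the distance from [u k.+1] to [u k.+3] is at
   most [a * b + (1 - a) < 1]. *)
have := cyc_far k.+3; rewrite -jE4 /dist k5E k3E k2E jE pE.
have -> : w + t + b *: (w - (w + t)) - (1 *: w + q *: - t) = (1 - b + q) *: t by vec.
rewrite nrm_scale_ge0 ?t1 ?mulr1; last lra.
move=> bq; have := cyc_far k.+1; rewrite /dist k1E k3E k2E kE jE.
have -> : t + a *: (w + t - t) - (w + t + b *: (w - (w + t))) =
  a *: (b *: t) + (1 - a) *: (b *: t - w) by vec.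
have h1 : N (b *: t - w) <= 1.
  have := nrm_comb N (- w) (- (w - q *: t)) (_ : 0 <= q - b) (_ : 0 <= b).
  have -> : (q - b) *: - w + b *: - (w - q *: t) = q *: (b *: t - w) by vec.
  have -> : w - q *: t = bd N (u j.+1) by rewrite k5E pE; vec.
  rewrite !nrmN bd_unit w1 nrm_scale_ge0 ?(ltW q0) // => H.
  by rewrite -(ler_pM2l q0); have := H _ _; lra.
have := nrm_comb N (b *: t) (b *: t - w) (_ : 0 <= a) (_ : 0 <= 1 - a).
rewrite nrm_scale_ge0 ?t1; last lra.
move=> H; have {}H := H _ _.
have a1 : 0 < a * (1 - b) by apply: mulr_gt0; lra.
have a2 : 0 <= (1 - a) * (1 - N (b *: t - w)) by apply: mulr_ge0; lra.
lra.
Qed.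
End strict.
End upper_bounds.

(** * Counting active points in the strict case *)

Section strict_count.
Context {R : realType}.
Local Notation plane := 'rV[R]_2.
Variable N : plane_norm R.
Implicit Types (x z v w t : plane) (a b c y : R).

Lemma bd_lift_inj n u k l : cyc_seq N (fun d => d < 1) n u ->
  (k < l)%N -> bd N (u k) = bd N (u l) -> (k + n <= l)%N.
Proof.
move=> uP kl e; rewrite leqNgt; apply/negP => ln.
have := cyc_lt uP kl; have := cyc_lt uP ln; rewrite (turn_per (cyc_turn uP)) => h1 h2.
have e' : u k = u l by apply: (bd_inj _ e); rewrite h1 (ltW h2).
by rewrite e' ltxx in h2.
Qed.

(** Four quarter turns of at most three steps each lead from [t] through [w], [- t] and [- w] back
    to [t]. *)
Lemma four_active_le12 n u t w : cyc_seq N (fun d => d < 1) n u -> 0 < det2 t w ->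
  occurs_active N u t -> occurs_active N u w ->
  occurs_active N u (- t) -> occurs_active N u (- w) -> (n <= 12)%N.
Proof.
move=> uP dtw ot ow omt omw.
have [[k0 k0E] _] := ot.
have dwt : 0 < det2 w (- t) by rewrite det2Nr det2C opprK.
have dtw' : 0 < det2 (- t) (- w) by rewrite det2Nl det2Nr opprK.
have dwt' : 0 < det2 (- w) (- - t) by rewrite opprK det2Nl det2C opprK.
have [k1 [/andP[k01 k1l] _ k1E]] := quarter_turn uP ot ow omt dtw k0E.
have [k2 [/andP[k12 k2l] _ k2E]] := quarter_turn uP ow omt omw dwt k1E.
have ot' : occurs_active N u (- - t) by rewrite opprK.
have ow' : occurs_active N u (- - w) by rewrite opprK.
have [k3 [/andP[k23 k3l] _ k3E]] := quarter_turn uP omt omw ot' dtw' k2E.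
have [k4 [/andP[k34 k4l] _ k4E]] := quarter_turn uP omw ot' ow' dwt' k3E.
have k04 : (k0 < k4)%N by rewrite (ltn_trans k01) // (ltn_trans k12) // (ltn_trans k23).
have nk4 : (k0 + n <= k4)%N.
  by apply: (bd_lift_inj uP k04); rewrite k0E k4E opprK.
have k4k0 : (k4 <= k0 + 12)%N.
  rewrite (leq_trans k4l) // -addn3 (_ : 12 = 9 + 3)%N // addnA leq_add2r.
  rewrite (leq_trans k3l) // -addn3 (_ : 9 = 6 + 3)%N // addnA leq_add2r.
  rewrite (leq_trans k2l) // -addn3 (_ : 6 = 3 + 3)%N // addnA leq_add2r.
  by rewrite addn3.
by rewrite -(leq_add2l k0) (leq_trans nk4).
Qed.

(* For every [i], [i] or [i + 6] is short, and if [i] is short then [i + 2] or [i + 4]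
   is active; so the number of indices is at most four times that of active ones. *)
Lemma many_active n u : cyc_seq N (fun d => d < 1) n.+1 u -> (12 < n.+1)%N ->
  (4 <= #|[pred i : 'I_n.+1 | `[< active N u i >]]|)%N.
Proof.
move=> uP n13.
pose s (i : 'I_n.+1) := `[< short u i >].
pose a (i : 'I_n.+1) := `[< active N u i >].
have sa i : (s i <= a (i + inord 2)%R + a (i + inord 4)%R)%N.
  rewrite /s /a; case: asboolP => //= si.
  rewrite !inordK ?(leq_ltn_trans _ n13) //.
  rewrite addn_gt0 !lt0b; case: (short_active uP si) => ai; apply/orP.
    by left; apply/asboolP/(active_mod uP); rewrite addn2.
  by right; apply/asboolP/(active_mod uP); rewrite addn4.
(* If neither were short, twelve steps would make a full turn, although [n.+1 > 12]. *)
have ss i : (1 <= s i + s (i + inord 6)%R)%N.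
  rewrite /s; case: asboolP => //= si; rewrite inordK ?(leq_ltn_trans _ n13) //.
  rewrite lt0b; apply/asboolP/(short_mod uP).
  move: si; rewrite /short => /negP; rewrite -leNgt => si.
  have : u (i + 12)%N < u (i + n.+1)%N by apply: (cyc_lt uP); rewrite ltn_add2l.
  rewrite (turn_per (cyc_turn uP)) !addnS addn0; lra.
have shift (f : 'I_n.+1 -> nat) (c : 'I_n.+1) : (\sum_i f (i + c)%R = \sum_i f i)%N.
  by rewrite [RHS](reindex_inj (addIr c)).
have h1 : (n.+1 <= (\sum_i s i) + \sum_i s i)%N.
  rewrite -[X in (_ <= _ + X)%N](shift (fun i => nat_of_bool (s i)) (inord 6)) -big_split /=.
  rewrite -[X in (X <= _)%N]card_ord -sum1_card; exact: leq_sum.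
have h2 : (\sum_i s i <= (\sum_i a i) + \sum_i a i)%N.
  rewrite -[X in (_ <= X + _)%N](shift (fun i => nat_of_bool (a i)) (inord 2)).
  rewrite -[X in (_ <= _ + X)%N](shift (fun i => nat_of_bool (a i)) (inord 4)) -big_split /=.
  exact: leq_sum.
have -> : #|[pred i : 'I_n.+1 | `[< active N u i >]]| = (\sum_i a i)%N.
  rewrite -sum1_card big_mkcond /=; apply: eq_bigr => i _.
  by rewrite inE /a; case: `[< _ >].
rewrite leqNgt; apply/negP => a3.
have : (12 < 12)%N; last by [].
rewrite {1}(leq_trans n13) // (leq_trans h1) // (_ : 12 = 6 + 6)%N // leq_add //;
  by rewrite (leq_trans h2) // (_ : 6 = 3 + 3)%N // leq_add.
Qed.

(** More than 12 points give at least four active vectors. They are bad, so by [bad_le2] they are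
    exactly two antipodal pairs. *)
Lemma cyc_seq_le12 n u : cyc_seq N (fun d => d < 1) n u -> (n <= 12)%N.
Proof.
case: n => [//|n] uP; rewrite leqNgt; apply/negP => n13.
have a4 := many_active uP n13.
pose A := [pred i : 'I_n.+1 | `[< active N u i >]].
pose p (i : 'I_n.+1) := bd N (u i).
pose s := [seq p i | i <- enum A].
have sz : size s = #|A| by rewrite size_map -cardE.
have us : uniq s.
  rewrite map_inj_in_uniq ?enum_uniq // => i j _ _ e.
  by apply: val_inj; exact: (bd_mod_inj (cyc_turn uP) (ltn_ord i) (ltn_ord j) e).
have sA x : x \in s -> exists2 i, active N u i & bd N (u i) = x.
  by move=> /mapP[i]; rewrite mem_enum => /asboolP ai ->; exists (nat_of_ord i).
have sb x : x \in s -> bad N x.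
  by move=> /sA[i ai <-]; exact: (active_bad uP).
have occ x : x \in s -> occurs_active N u x.
  move=> /mapP[i]; rewrite mem_enum => /asboolP ai xE; split.
    by exists (nat_of_ord i).
  move=> j jE; apply/(active_mod uP).
  suff -> : (j %% n.+1)%N = i by [].
  by apply: (@bd_mod_inj _ N _ _ (cyc_turn uP)); rewrite ?ltn_mod // (bd_mod N (cyc_turn uP)) jE xE.
have [t ts] : exists t, t \in s.
  case: (s) sz => [|t s'] /= e; last by exists t; rewrite mem_head.
  by move: a4; rewrite -e.
have [[w [ws dtw]]|par] := pselect (exists w, w \in s /\ det2 t w != 0); last first.
  have /(uniq_leq_size us) : {subset s <= [:: t; - t]}.
    move=> x xs; rewrite !inE.
    have [|->|->] := @unit_parallel R N t x (bad_unit (sb _ ts)) (bad_unit (sb _ xs)).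
    - by apply/eqP; apply: contrapT => /negP dx; apply: par; exists x.
    - by rewrite eqxx.
    - by rewrite eqxx orbT.
  by rewrite sz /= leqNgt (leq_trans _ a4).
have sub : {subset s <= [:: t; - t; w; - w]}.
  move=> x xs; rewrite !inE.
  case: (bad_le2 (sb _ ts) (sb _ ws) (sb _ xs) dtw) => d0.
    case: (unit_parallel (bad_unit (sb _ ts)) (bad_unit (sb _ xs)) d0) => ->;
      by rewrite eqxx ?orbT.
  case: (unit_parallel (bad_unit (sb _ ws)) (bad_unit (sb _ xs)) d0) => ->;
    by rewrite eqxx ?orbT.
have /= [] := uniq_min_size us sub; first by rewrite sz.
move=> _ sE.
have ot := occ t ts; have ow := occ w ws.
have omt : occurs_active N u (- t) by apply: occ; rewrite sE !inE eqxx orbT.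
have omw : occurs_active N u (- w) by apply: occ; rewrite sE !inE eqxx !orbT.
suff : (n.+1 <= 12)%N by rewrite leqNgt n13.
have [d0|d0] := ltP 0 (det2 t w); first exact: (four_active_le12 uP d0).
apply: (four_active_le12 (w := - w) uP _ ot omw omt).
  by rewrite det2Nr oppr_gt0 lt_neqAle dtw.
by rewrite opprK.
Qed.
End strict_count.

(** * Extremal configurations *)

Section constructions.
Context {R : realType}.
Local Notation plane := 'rV[R]_2.
Variable N : plane_norm R.
Implicit Types (x z v w t : plane) (a b c e y : R).

(** Agreement reaches [m.+1], because the double step from the last index [m.-1] of a period ends
    there. *)
Lemma periodic_extension m (om : R) (f : nat -> R) : (1 < m)%N ->
  f m = f 0%N + om -> f m.+1 = f 1%N + om ->
  exists u : nat -> R, (forall i, (i <= m.+1)%N -> u i = f i) /\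
    (forall i, u (i + m)%N = u i + om).
Proof.
move=> m1 fm fm1; have m0 : (0 < m)%N by exact: ltnW.
exists (fun i => f (i %% m)%N + (i %/ m)%:R * om); split.
  move=> i; rewrite leq_eqVlt => /predU1P[->|].
    by rewrite fm1 -addn1 modnDl divnDl // divnn m0 modn_small // divn_small // addn0 mul1r.
  rewrite ltnS leq_eqVlt => /predU1P[->|im].
    by rewrite modnn divnn m0 fm mul1r.
  by rewrite modn_small // divn_small // mul0r addr0.
move=> i; rewrite modnDr divnDr // divnn m0 addn1 -natr1; ring.
Qed.

Lemma periodic_ind m (Q : nat -> Prop) : (0 < m)%N ->
  (forall i, (i < m)%N -> Q i) -> (forall i, Q i -> Q (i + m)%N) -> forall i, Q i.
Proof.
move=> m0 Q0 Qm; elim/ltn_ind => i IH; have [/Q0//|mi] := ltnP i m.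
rewrite -(subnK mi); apply/Qm/IH; rewrite -subn_gt0 subKn //.
Qed.

(** The period [om] is a half turn with [k = 2] for centrally symmetric sequences and a full turn
    with [k = 1] for the eleven points. *)
Lemma cyc_seq_periodic (P : R -> Prop) m k (om : R) (f : nat -> R) : (1 < m)%N ->
  k%:R * om = 2 * pi -> (forall a b, dist N (a + om) (b + om) = dist N a b) ->
  f m = f 0%N + om -> f m.+1 = f 1%N + om ->
  (forall i, (i < m)%N -> [/\ f i < f i.+1, f i.+2 <= f i + pi,
     P (dist N (f i) (f i.+1)) & ~ P (dist N (f i) (f i.+2))]) ->
  exists u, cyc_seq N P (k * m) u.
Proof.
move=> m1 kom dom fm fm1 h; have m0 : (0 < m)%N by exact: ltnW.
have [u [uf um]] := periodic_extension m1 fm fm1.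
have {h} H : forall i, [/\ u i < u i.+1, u i.+2 <= u i + pi,
     P (dist N (u i) (u i.+1)) & ~ P (dist N (u i) (u i.+2))].
  apply: (periodic_ind m0) => i.
    by move=> im; rewrite !uf ?(ltnW im) //; [exact: h|rewrite ltnW|rewrite ltnW// ltnW].
  rewrite -!addSn !um !dom => -[h1 h2 h3 h4]; split => //; lra.
exists u; split; try by move=> i; case: (H i).
move=> i; rewrite -kom; elim: k {kom} => [|k IH]; first by rewrite addn0 mul0r addr0.
by rewrite mulSn addnCA addnC um IH -natr1; ring.
Qed.

Lemma cyc_seq_vectors (P : R -> Prop) m (v : nat -> plane) : (1 < m)%N ->
  v m = - v 0%N -> v m.+1 = - v 1%N ->
  (forall i, (i < m)%N -> N (v i) = 1) ->
  (forall i, (0 < i < m)%N -> 0 < det2 (v 0%N) (v i)) ->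
  (forall i, (i.+1 < m)%N -> 0 < det2 (v i) (v i.+1)) ->
  (forall i, (i < m)%N -> P (N (v i - v i.+1))) ->
  (forall i, (i < m)%N -> ~ P (N (v i - v i.+2))) ->
  exists u, cyc_seq N P (2 * m) u.
Proof.
move=> m1 vm vm1 v1 v0 vS nearv farv; have m0 : (0 < m)%N by exact: ltnW.
have [a _ aE] := unit_bd 0 (v1 0%N m0).
have /choice[g gP] : forall i, exists y, (0 < i < m)%N -> a < y < a + pi /\ bd N y = v i.
  move=> i; have [im|im] := boolP (0 < i < m)%N; last by exists 0.
  have d0 := v0 i im; have vi : N (v i) = 1 by apply: v1; case/andP: im.
  by rewrite aE in d0; have [y ya yE] := unit_bd_gt0 vi d0; exists y.
pose f i := if i == 0%N then a else if (i < m)%N then g i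
            else if i == m then a + pi else g 1%N + pi.
have f0 : f 0%N = a by [].
have fg i : (0 < i < m)%N -> f i = g i.
  by move=> /andP[i0 im]; rewrite /f gtn_eqF // im.
have fm : f m = f 0%N + pi by rewrite /f gtn_eqF // ltnn eqxx.
have fm1 : f m.+1 = f 1%N + pi.
  by rewrite (fg 1%N) ?m1 // /f /= ltnNge leqnSn /= gtn_eqF.
have fE i : (i <= m.+1)%N -> bd N (f i) = v i.
  rewrite leq_eqVlt => /predU1P[->|].
    by rewrite fm1 bdDpi vm1 fg ?m1 //; have [_ ->] := gP 1%N m1.
  rewrite ltnS leq_eqVlt => /predU1P[->|im]; first by rewrite fm bdDpi vm f0 -aE.
  case: i im => [|i] im; first by rewrite f0 -aE.
  by rewrite fg //; have [_ ->] := gP i.+1 im.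
have finc i : (i < m)%N -> f i < f i.+1.
  move=> im; have : (i.+1 <= m)%N := im; rewrite leq_eqVlt => /predU1P[e|im1].
    rewrite e fm f0; have i0 : (0 < i < m)%N by rewrite -e ltnS leqnn andbT -ltnS e.
    by rewrite fg //; have [] := gP i i0; lra.
  case: i im im1 => [|i] im im1.
    by rewrite f0 fg //; have [] := gP 1%N im1; lra.
  have [gi giE] := gP i.+1 im; have [gi1 gi1E] := gP i.+2 im1.
  by rewrite !fg //; apply: (@bd_order _ N a _ _ gi gi1); rewrite giE gi1E vS.
apply: (@cyc_seq_periodic P m 2 pi f) => //; first exact: dist_pi2.
move=> i im; split.
- exact: finc.
- have : (i.+2 <= m.+1)%N := im; rewrite leq_eqVlt => /predU1P[e|].
    have ei : i.+1 = m by case: e.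
    rewrite e fm1 lerD2r; case: i im e ei => [|i] im e ei.
      by move: m1; rewrite -ei.
    have : forall j, (0 < j <= i.+1)%N -> f 1%N <= f j.
      elim=> [//|[_ //|j] IH] /andP[_ ji]; apply: (le_trans (IH _)); first by rewrite /= ltnW.
      by apply/ltW/finc; rewrite (leq_ltn_trans _ im) // ltnW.
    by apply; rewrite /= leqnn.
  rewrite ltnS leq_eqVlt => /predU1P[->|im2].
    rewrite fm f0 lerD2r; case: i im => [|i] im; first by rewrite f0.
    by rewrite fg //; have [] := gP i.+1 im; lra.
  rewrite (fg i.+2) //; have [gi _] := gP i.+2 im2.
  case: i im gi {im2} => [|i] im gi; first by rewrite f0; lra.
  by rewrite fg //; have [] := gP i.+1 im; lra.
- by rewrite /dist !fE ?leqW ?(ltnW im) //; exact: nearv.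
- by rewrite /dist (fE i.+2) // fE ?leqW ?(ltnW im) //; exact: farv.
Qed.

(** The lower bound is [bump_support] with [e = 1]. For the upper bound with [a >= b >= 0], write
    the vector as [b *: (t + w) + (a - b) *: t]. *)
Lemma square_norm t w : N t = 1 -> N w = 1 -> N (t + w) <= 1 -> N (t - w) <= 1 ->
  forall a b, N (a *: t + b *: w) = Num.max `|a| `|b|.
Proof.
move=> t1 w1 pw mw a b; apply/eqP; rewrite eq_le; apply/andP; split; last first.
  rewrite ge_max; apply/andP; split.
    by apply: (@bump_support _ N t w 1) => //; rewrite scale1r.
  rewrite addrC; apply: (@bump_support _ N w t 1) => //; rewrite scale1r.
    by rewrite addrC.
  by rewrite nrmB.
wlog a0 : a b / 0 <= a.
  move=> H; have [a0|a0] := leP 0 a; first exact: H.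
  have -> : a *: t + b *: w = - ((- a) *: t + (- b) *: w) by vec.
  by rewrite nrmN -[`|a|]normrN -[`|b|]normrN; apply: H; lra.
wlog b0 : b w w1 pw mw / 0 <= b.
  move=> H; have [b0|b0] := leP 0 b; first exact: H.
  have -> : b *: w = (- b) *: - w by vec.
  by rewrite -[`|b|]normrN; apply: H; rewrite ?nrmN ?opprK //; lra.
rewrite !ger0_norm // le_max; apply/orP; have [ab|ba] := leP b a; [left|right].
  have := nrm_comb N (t + w) t b0 (_ : 0 <= a - b).
  have -> : b *: (t + w) + (a - b) *: t = a *: t + b *: w by vec.
  rewrite t1 => H; have {}H := H _; have := ler_wpM2l b0 pw; lra.
have := nrm_comb N (t + w) w a0 (_ : 0 <= b - a).
have -> : a *: (t + w) + (b - a) *: w = a *: t + b *: w by vec.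
rewrite w1 => H; have {}H := H _; have := ler_wpM2l a0 pw; lra.
Qed.

Definition comb_seq t w (s : seq (R * R)) i : plane :=
  (nth (0, 0) s i).1 *: t + (nth (0, 0) s i).2 *: w.

Lemma square_cyc_seq (P : R -> Prop) m (s : seq (R * R)) : square N -> (1 < m)%N ->
  (forall t w, comb_seq t w s m = - comb_seq t w s 0) ->
  (forall t w, comb_seq t w s m.+1 = - comb_seq t w s 1) ->
  let p i := nth (0, 0) s i in
  let d (x y : R * R) := Num.max `|x.1 - y.1| `|x.2 - y.2| in
  (forall i, (i < m)%N -> d (p i) (0, 0) = 1) ->
  (forall i, (0 < i < m)%N -> 0 < (p 0%N).1 * (p i).2 - (p 0%N).2 * (p i).1) ->
  (forall i, (i.+1 < m)%N -> 0 < (p i).1 * (p i.+1).2 - (p i).2 * (p i.+1).1) ->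
  (forall i, (i < m)%N -> P (d (p i) (p i.+1))) ->
  (forall i, (i < m)%N -> ~ P (d (p i) (p i.+2))) ->
  exists u, cyc_seq N P (2 * m) u.
Proof.
move=> [t [w [t1 w1 pw mw]]] m1 sm sm1 p d h1 h0 hS hn hf.
wlog d0 : w w1 pw mw / 0 < det2 t w.
  move=> H; have [d0|d0] := ltP 0 (det2 t w); first exact: (H w).
  apply: (H (- w)); rewrite ?nrmN ?opprK // det2Nr oppr_gt0 lt_neqAle d0 andbT.
  apply/eqP => /(unit_parallel t1 w1)[] wE; move: pw mw; rewrite wE.
    by rewrite -mulr2n -scaler_nat nrm_scale_ge0 ?t1 //; lra.
  by rewrite opprK -mulr2n -scaler_nat nrm_scale_ge0 ?t1 //; lra.
have nE := square_norm t1 w1 pw mw.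
have dE i j : N (comb_seq t w s i - comb_seq t w s j) = d (p i) (p j).
  rewrite /d -nE; congr (N _); rewrite /comb_seq -/(p i) -/(p j).
  by vec.
have detE i j : det2 (comb_seq t w s i) (comb_seq t w s j) =
    ((p i).1 * (p j).2 - (p i).2 * (p j).1) * det2 t w.
  by rewrite /comb_seq -/(p i) -/(p j) !det2Dl !det2Dr !det2Zl !det2Zr !det2vv (det2C t w); ring.
apply: (@cyc_seq_vectors P m (comb_seq t w s)) => // i im.
- by rewrite -(h1 i im) /comb_seq nE /d /= !subr0.
- by rewrite detE mulr_gt0 // h0.
- by rewrite detE mulr_gt0 // hS.
- by rewrite dE; exact: hn.
- by rewrite dE; exact: hf.
Qed.

Lemma square_cyc_seq8 : square N -> exists u, cyc_seq N (fun d => d <= 1) 8 u.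
Proof.
move=> sq; pose h : R := 2^-1.
(* Two points on each side of the square, a quarter of the side from its ends. Consecutive points
   are at distance 1 or 1/2, every second ones at distance 3/2. The last two entries repeat the
   first two with opposite sign. *)
pose s : seq (R * R) := [:: (1, - h); (1, h); (h, 1); (- h, 1); (-1, h); (-1, - h)].
have hh : h = 2^-1 by [].
apply: (@square_cyc_seq _ 4 s sq) => //.
- by move=> t w; rewrite /comb_seq /=; vec.
- by move=> t w; rewrite /comb_seq /=; vec.
- by do 4 (case=> [_|]; first by
    rewrite /= !subr0 ?normrN !gtr0_norm /Num.max /=; try lra; case: ifP; lra).
- by case=> [//|]; do 3 (case=> [_|]; first by rewrite /= hh; lra).
- by do 3 (case=> [_|]; first by rewrite /= hh; lra).
- by do 4 (case=> [_|]; first by rewrite /= ge_max !ler_norml; lra).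
- by do 4 (case=> [_|]; first by rewrite /= ge_max !ler_norml; lra).
Qed.

Lemma square_cyc_seq12 : square N -> exists u, cyc_seq N (fun d => d < 1) 12 u.
Proof.
move=> sq; pose h : R := 2^-1.
(* With the midpoints of the sides added, all single steps have length 1/2 and all double steps
   length 1. *)
pose s : seq (R * R) := [:: (1, - h); (1, 0); (1, h); (h, 1); (0, 1); (- h, 1);
  (-1, h); (-1, 0)].
have hh : h = 2^-1 by [].
apply: (@square_cyc_seq _ 6 s sq) => //.
- by move=> t w; rewrite /comb_seq /=; vec.
- by move=> t w; rewrite /comb_seq /=; vec.
- by do 6 (case=> [_|]; first by
    rewrite /= !subr0 ?normrN ?normr0 !gtr0_norm /Num.max /=; try lra; case: ifP; lra).
- by case=> [//|]; do 5 (case=> [_|]; first by rewrite /= hh; lra).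
- by do 5 (case=> [_|]; first by rewrite /= hh; lra).
- by do 6 (case=> [_|]; first by rewrite /= gt_max !ltr_norml; lra).
- by do 6 (case=> [_|]; first by rewrite /= gt_max !ltr_norml; lra).
Qed.

(** Away from bad vectors chords through length 1 grow strictly. The four lemmas treat a chord
    inside ([near]) or around ([far]) a unit chord, sharing with it the first end ([r]) or the last
    ([l]), which is not bad. *)
Lemma near_r a b c : a < b < c -> c < a + pi -> dist N a c = 1 -> ~ bad N (bd N a) ->
  dist N a b < 1.
Proof.
move=> abc ca d1 nb; rewrite lt_neqAle -{2}d1 dist_mono_r ?andbT; try lra.
apply/eqP => d1'; apply: nb.
by have [al [_ _ le]] := flat_r abc ca d1' d1; exists (bd N c - bd N a), (1 + al).
Qed.

Lemma near_l a b c : a < b < c -> c < a + pi -> dist N a c = 1 -> ~ bad N (bd N c) ->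
  dist N b c < 1.
Proof.
move=> abc ca d1 nb; rewrite lt_neqAle -{2}d1 dist_mono_l ?andbT; try lra.
apply/eqP => d1'; apply: nb; exact: (flat_l abc ca d1' d1).
Qed.

Lemma far_r a b c : a < b < c -> c <= a + pi -> dist N a b = 1 -> ~ bad N (bd N a) ->
  1 < dist N a c.
Proof.
move=> abc; rewrite le_eqVlt => /predU1P[->|ca] d1 nb; first by rewrite distDpi; lra.
have h : dist N a b <= dist N a c by apply: dist_mono_r; lra.
rewrite lt_neqAle -{2}d1 h andbT; apply/eqP => d1'; apply: nb.
by have [al [_ _ le]] := flat_r abc ca d1 (esym d1'); exists (bd N c - bd N a), (1 + al).
Qed.

Lemma far_l a b c : a < b < c -> c <= a + pi -> dist N b c = 1 -> ~ bad N (bd N c) ->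
  1 < dist N a c.
Proof.
move=> abc; rewrite le_eqVlt => /predU1P[->|ca] d1 nb; first by rewrite distDpi; lra.
have h : dist N b c <= dist N a c by apply: dist_mono_l; lra.
rewrite lt_neqAle -{2}d1 h andbT; apply/eqP => d1'; apply: nb.
exact: (flat_l abc ca d1 (esym d1')).
Qed.

Lemma exists_good_turn : ~ square N -> exists h : nat -> R,
  [/\ forall i, h i < h i.+1, forall i, h (i + 3)%N = h i + pi,
      forall i, dist N (h i) (h i.+1) = 1 & forall i, ~ bad N (bd N (h i))].
Proof.
move=> /exists_good_hexagon[a0 [a1 [a2 [a012 a20 [d01 d12 d23] [b0 b1 b2]]]]].
pose f i := nth 0 [:: a0; a1; a2; a0 + pi; a1 + pi] i.
have [h [hf h3]] := @periodic_extension 3 pi f erefl erefl erefl.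
exists h.
have H : forall i, [/\ h i < h i.+1, dist N (h i) (h i.+1) = 1 & ~ bad N (bd N (h i))].
  apply: (@periodic_ind 3) => // i.
    case: i => [_|[_|[_|//]]]; rewrite !hf //; split => //; rewrite /f /=; lra.
  rewrite -addSn !h3 ltrD2r dist_pi2 bdDpi => -[h1 h2 nb]; split => //.
  by move=> /badN; rewrite opprK.
by split => // i; case: (H i).
Qed.

Ltac lra_order :=
  repeat match goal with H : context[dist _ _ _] |- _ => clear H end; lra.

(** Double steps stay within one of the two hexagons and have length 1. Each single step is properly
    contained in a unit chord with which it shares a vertex [h i], so it is shorter than 1. *)
Lemma good_cyc_seq12 : ~ square N -> exists u, cyc_seq N (fun d => d < 1) 12 u.
Proof.
move=> /exists_good_turn[h [inc h3 d1 nb]].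
have h03 : h 3%N = h 0%N + pi := h3 0%N.
have i01 := inc 0%N; have i12 := inc 1%N; have i23 := inc 2%N.
pose b := (h 0%N + h 1%N) / 2.
have b01 : h 0%N < b < h 1%N by rewrite /b; lra.
have nb01 : dist N b (h 1%N) < 1 by apply: near_l b01 _ (d1 0%N) (nb _); lra.
have fb2 : 1 < dist N b (h 2%N) by apply: far_l (d1 1%N) (nb _); lra.
have [||q bq dbq] := @dist_ivt R N b (h 2%N); [lra|lra|].
have q1 : h 1%N < q.
  rewrite ltNge; apply/negP => q1.
  by have := @dist_mono_r R N b q (h 1%N); lra.
have q2 : q < h 2%N.
  rewrite lt_neqAle; case/andP: bq => _ ->; rewrite andbT; apply/eqP => e.
  by move: fb2; rewrite -e dbq ltxx.
have nq2 : dist N q (h 2%N) < 1 by apply: near_l (d1 1%N) (nb _); lra.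
have fq3 : 1 < dist N q (h 3%N) by apply: far_l (d1 2%N) (nb _); lra.
have [|r qr rE] := hexagon _ dbq; first by lra.
have dqr : dist N q r = 1.
  by rewrite /dist rE opprB addrCA subrr addr0 bd_unit.
have drb : dist N r (b + pi) = 1.
  by rewrite /dist rE bdDpi opprK subrK bd_unit.
have r2 : h 2%N < r.
  rewrite ltNge; apply/negP => r2.
  by have := @dist_mono_r R N q r (h 2%N); lra.
have r3 : r < h 3%N.
  rewrite ltNge; apply/negP => r3.
  by have := @dist_mono_r R N q (h 3%N) r; lra.
pose f i := nth 0 [:: h 0%N; b; h 1%N; q; h 2%N; r; h 0%N + pi; b + pi] i.
apply: (@cyc_seq_periodic _ 6 2 pi f) => //; first exact: dist_pi2.
case=> [_|[_|[_|[_|[_|[_|//]]]]]]; rewrite /f /=;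
  (split; [by lra_order|by lra_order| |]);
  rewrite ?d1 ?dbq ?dqr ?drb ?ltxx // -?h03 ?d1 ?ltxx //.
- by apply: near_r (d1 0%N) (nb _); lra_order.
- by apply: near_r (d1 1%N) (nb _); lra_order.
- by apply: near_r (d1 2%N) (nb _); lra_order.
- by apply: near_l (d1 2%N) (nb _); lra_order.
Qed.

Lemma pick_right a e c b : a < e -> 1 < dist N a c -> dist N a b < 1 ->
  exists y, [/\ a < y < e, 1 < dist N y c & dist N y b < 1].
Proof.
move=> ae dc db.
have nc : \forall y \near a^'+, 1 < dist N y c.
  have cv : dist N y c @[y --> a^'+] --> dist N a c.
    by apply: cvg_at_right_filter; exact: dist_continuous.
  exact: (cvgr_gt _ cv).
have nb : \forall y \near a^'+, dist N y b < 1.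
  have cv : dist N y b @[y --> a^'+] --> dist N a b.
    by apply: cvg_at_right_filter; exact: dist_continuous.
  exact: (cvgr_lt _ cv).
have na : \forall y \near a^'+, a < y by exact: nbhs_right_gt.
have ne : \forall y \near a^'+, y < e by exact: nbhs_right_lt.
near a^'+ => y; exists y; split; near: y => //.
by apply: filterS2 na ne => y -> ->.
Unshelve. all: by end_near. Qed.

(* With the vertices h_0, h_1, .. of a good hexagon (h_6 is h_0 again), a chain of
   eleven points slightly after h_0, .., h_10, each at distance more than 1 from the
   preceding one, is built from its far end. *)
Lemma good_cyc_seq11 : ~ square N -> exists u, cyc_seq N (fun d => d <= 1) 11 u.
Proof.
move=> /exists_good_turn[h [inc h3 d1 nb]].
have gap i : h i.+2 < h i + pi by rewrite -h3 addn3.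
have gap3 i : h i.+3 = h i + pi by rewrite -h3 addn3.
have h60 : h 6%N = h 0%N + 2 * pi by rewrite !gap3; lra.
have h71 : h 7%N = h 1%N + 2 * pi by rewrite !gap3; lra.
have next i c e : h i.+1 < c <= h i + pi -> h i < e -> exists y,
    [/\ h i < y < e, 1 < dist N y c & dist N y (h i) < 1].
  move=> hc he; apply: pick_right => //; last by rewrite distxx ltr01.
  by apply: far_r (d1 i) (nb i); have := inc i; lra.
have next2 i c e b : h i.+1 < c <= h i + pi -> h i < e -> h i.-1 < b < h i -> (0 < i)%N ->
    exists y, [/\ h i < y < e, 1 < dist N y c & dist N y b < 1].
  move=> hc he hb i0; apply: pick_right => //.
    by apply: far_r (d1 i) (nb i); have := inc i; lra.
  rewrite distC; apply: near_l hb _ _ (nb i).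
    by case: i i0 {hc he} => // i _; have := gap i; have := inc i.+1; lra.
  by case: i i0 {hc he}.
have near_w i y : h i < y < h i.+1 -> dist N (h i) y < 1.
  by move=> hw; apply: near_r hw _ (d1 i) (nb i); have := gap i; have := inc i.+1; lra.
have near_xw i c y : h i < c < y -> y < h i.+1 -> dist N c y <= 1.
  move=> xw wi; have yi : h i < y < h i.+1 by lra.
  apply: ltW; apply: le_lt_trans (near_w _ _ yi).
  by apply: dist_mono_l; have := gap i; have := inc i.+1; lra.
have i0 := inc 0%N; have i1 := inc 1%N; have i2 := inc 2%N; have i3 := inc 3%N.
have i4 := inc 4%N; have i5 := inc 5%N.
have g0 := gap 0%N; have g1 := gap 1%N; have g2 := gap 2%N; have g3 := gap 3%N; have g4 := gap 4%N.
have p0 := gap3 0%N; have p1 := gap3 1%N; have p2 := gap3 2%N; have p3 := gap3 3%N.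
have p4 := gap3 4%N.
(* The second lap, built backwards from [h 6]: each [w] lies just after its vertex and is farther
   than 1 from its successor. *)
have [||w4 [w4i f46 _]] := @next 4 (h 6%N) (h 5%N); [lra_order|lra_order|].
have [||w3 [w3i f34 _]] := @next 3 w4 (h 4%N); [lra_order|lra_order|].
have [||w2 [w2i f23 _]] := @next 2 w3 (h 3%N); [lra_order|lra_order|].
have [||w1 [w1i f12 _]] := @next 1 w2 (h 2%N); [lra_order|lra_order|].
have [||w0 [w0i f01 _]] := @next 0 w1 (h 1%N); [lra_order|lra_order|].
(* The first lap, which continues into the second at [w0 + 2 * pi]. Each [x] must also stay within 1
   of the [w] of the preceding vertex. *)
have [||||x5 [x5i g50 n5]] := @next2 5 (w0 + 2 * pi) (h 6%N) w4; [lra_order|lra_order|lra_order|by []|].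
have [||||x4 [x4i g45 n4]] := @next2 4 x5 w4 w3; [lra_order|lra_order|lra_order|by []|].
have [||||x3 [x3i g34 n3]] := @next2 3 x4 w3 w2; [lra_order|lra_order|lra_order|by []|].
have [||||x2 [x2i g23 n2]] := @next2 2 x3 w2 w1; [lra_order|lra_order|lra_order|by []|].
have [||||x1 [x1i g12 n1]] := @next2 1 x2 w1 w0; [lra_order|lra_order|lra_order|by []|].
have f01' : 1 < dist N (h 0%N) x1 by apply: far_r (d1 0%N) (nb 0%N); lra_order.
pose f i := nth 0 [:: h 0%N; w0; x1; w1; x2; w2; x3; w3; x4; w4; x5;
                      h 0%N + 2 * pi; w0 + 2 * pi] i.
have far c y : 1 < dist N c y -> ~ (dist N c y <= 1).
  by rewrite ltNge => /negP.
apply: (@cyc_seq_periodic _ 11 1 (2 * pi) f) => //; [by rewrite mul1r|exact: dist_2pi|].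
have g5 := gap 5%N; clear i0 i1 i2 i3 i4 i5 p0 p1 p2 p3 p4.
case=> [_|[_|[_|[_|[_|[_|[_|[_|[_|[_|[_|//]]]]]]]]]]]; rewrite /f /=;
  (split; [by lra_order|by lra_order| |]); rewrite -?h60; try by apply: far.
- by apply/ltW/near_w.
- by rewrite distC ltW.
- by apply: near_xw (x1i) _; lra_order.
- by rewrite distC ltW.
- by apply: near_xw (x2i) _; lra_order.
- by rewrite distC ltW.
- by apply: near_xw (x3i) _; lra_order.
- by rewrite distC ltW.
- by apply: near_xw (x4i) _; lra_order.
- by rewrite distC ltW.
- by apply/ltW/near_l; [| |exact: (d1 5%N)|exact: nb]; have := gap 5%N; lra_order.
Qed.
End constructions.

(** * Families of unit vectors *)

Section hull.
Context {R : realType}.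
Local Notation plane := 'rV[R]_2.
Variable N : plane_norm R.
Implicit Types (S T : set plane) (x y z w : plane) (a b c e : R).

Lemma convex_setP (A : set plane) : convex_set A <->
  forall x y c, 0 <= c <= 1 -> A x -> A y -> A (c *: x + (1 - c) *: y).
Proof.
split=> [cA x y c /andP[c0 c1] Ax Ay|H x y l].
  have := cA x y (Itv01 c0 c1); rewrite !in_setE => /(_ Ax Ay).
  by [].
rewrite !in_setE => Ax Ay; apply: (H x y l%:num) => //.
by apply/andP; split.
Qed.

Lemma convex_hull_convex S : convex_set (convex_hull S).
Proof.
apply/convex_setP => x y c c01 Hx Hy A [cA SA].
by move/convex_setP : (cA); apply => //; [apply: Hx|apply: Hy].
Qed.

Lemma sub_convex_hull S : S `<=` convex_hull S.
Proof. exact: sub_gen_smallest. Qed.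

Lemma convex_hullS S T : S `<=` T -> convex_hull S `<=` convex_hull T.
Proof.
by move=> ST; apply: smallest_sub; [exact: convex_hull_convex|move=> x /ST; exact: sub_convex_hull].
Qed.

Lemma convex_hull0_comb S x y z a b c : S x -> S y -> S z ->
  0 <= a -> 0 <= b -> 0 < c -> a *: x + b *: y + c *: z = 0 -> convex_hull S 0.
Proof.
move=> Sx Sy Sz a0 b0 c0 e.
have cH := (convex_setP (convex_hull S)).1 (@convex_hull_convex S).
have H v : S v -> convex_hull S v by exact: sub_convex_hull.
have s0 : 0 < a + b + c by lra.
have [ab|ab] := eqVneq (a + b) 0.
  have a0' : a = 0 by lra.
  have b0' : b = 0 by lra.
  move: e; rewrite a0' b0' !scale0r !add0r => /eqP.
  by rewrite scaler_eq0 gt_eqF //= => /eqP <-; exact: H.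
have abp : 0 < a + b by rewrite lt_neqAle eq_sym ab addr_ge0.
have := cH (((a / (a + b)) *: x + (1 - a / (a + b)) *: y)) z ((a + b) / (a + b + c)).
have -> : ((a + b) / (a + b + c)) *: (((a / (a + b)) *: x + (1 - a / (a + b)) *: y)) +
  (1 - (a + b) / (a + b + c)) *: z = (a + b + c)^-1 *: (a *: x + b *: y + c *: z).
  by apply/rowP => i; rewrite !mxE; field; rewrite !gt_eqF.
rewrite e scaler0; apply.
- by rewrite divr_ge0 ?(ltW abp) ?(ltW s0) //= ler_pdivrMr // mul1r; lra.
- apply: cH; try exact: H.
  by rewrite divr_ge0 ?(ltW abp) //= ler_pdivrMr // mul1r; lra.
- exact: H.
Qed.

Lemma convex_hull0_half_plane S w : (forall x, S x -> 0 < det2 w x) -> ~ convex_hull S 0.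
Proof.
move=> h H; have /= : [set x | 0 < det2 w x] 0.
  apply: H; split => //; apply/convex_setP => x y c c01 /= x0 y0.
  rewrite det2Dr !det2Zr; have [c0|c0] := eqVneq c 0.
    by rewrite c0 mul0r subr0 mul1r add0r.
  rewrite ltr_wpDr //; first by apply: mulr_ge0; [lra|exact: ltW].
  by apply: mulr_gt0 => //; rewrite lt_neqAle eq_sym c0; case/andP: c01.
by rewrite /det2 !mxE !mulr0 subrr ltxx.
Qed.

Lemma convex_hull_finite S x : convex_hull S x ->
  exists T, [/\ T `<=` S, finite_set T & convex_hull T x].
Proof.
move=> H; have /= : [set x | exists T, [/\ T `<=` S, finite_set T & convex_hull T x]] x.
  apply: H; split; last first.
    move=> y Sy; exists [set y]; split; [by move=> _ ->|exact: finite_set1|].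
    exact: sub_convex_hull.
  apply/convex_setP => y z c c01 [T [TS fT Ty]] [U [US fU Uz]].
  exists (T `|` U); split.
  - by move=> v [/TS|/US].
  - by rewrite finite_setU.
  - have H' := (convex_setP _).1 (@convex_hull_convex (T `|` U)).
    apply: H' => //.
      by apply: convex_hullS Ty; exact: subsetUl.
    by apply: convex_hullS Uz; exact: subsetUr.
by [].
Qed.

Lemma hull_no_big_gap S a c : (forall x, S x -> N x = 1) -> convex_hull S 0 ->
  a + pi < c -> c <= a + 2 * pi -> exists2 b, a < b < c & S (bd N b).
Proof.
move=> S1 H ac ca; apply: contrapT => no.
(* The angles of [S] can be taken in [[c, a + 2 * pi]]. The direction midway between [a + pi] and
   [c] has all of them strictly inside the following half turn. *)
apply: (@convex_hull0_half_plane S (bd N ((a + pi + c) / 2))) H => x Sx.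
have [b ab xE] := unit_bd a (S1 x Sx).
rewrite {}xE in Sx *; have [ba|ba] := eqVneq b a.
  have -> : bd N b = bd N (a + 2 * pi) by rewrite ba bdD2pi.
  by apply: det2_bd_gt0; lra.
have cb : c <= b.
  rewrite leNgt; apply/negP => bc; apply: no; exists b => //.
  by rewrite bc andbT lt_neqAle eq_sym ba; case/andP: ab.
by apply: det2_bd_gt0; lra.
Qed.

(** The origin is a combination of [v 0], the first point beyond its antipode and the point before
    that one, weighted by their determinants. If the latter point is the antipode itself, it
    suffices with [v 0]. *)
Lemma hull_small_gaps S (v : nat -> R) m :
  (forall j, (j < m)%N -> v j < v j.+1 <= v j + pi) -> v m = v 0%N + 2 * pi ->
  (forall j, (j <= m)%N -> S (bd N (v j))) -> convex_hull S 0.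
Proof.
move=> vS vm Sv; have pi0 := @pi_gt0 R.
have exk : exists k, (k <= m)%N && (v 0%N + pi < v k) by exists m; rewrite leqnn vm; lra.
case: (ex_minnP exk) => k /andP[km kpi] kmin.
case: k km kpi kmin => [|k] km kpi kmin; first by lra.
have [vk vk1] := andP (vS k km).
have kle : v k <= v 0%N + pi.
  rewrite leNgt; apply/negP => h; have := kmin k; rewrite h (ltnW km) => /(_ isT).
  by rewrite ltnn.
case: k km kpi kmin vk vk1 kle => [|k] km kpi kmin vk vk1 kle; first by lra.
have inc j : (0 < j <= m)%N -> v 0%N < v j.
  elim: j => [//|[_|j IH] /andP[_ jm]]; first by have /andP[] := vS 0%N jm.
  apply: lt_trans (IH _) _; first by rewrite /= ltnW.
  by have /andP[] := vS j.+1 jm.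
have le2 : v k.+2 <= v 0%N + 2 * pi.
  rewrite -vm; move: km; rewrite leq_eqVlt => /predU1P[->//|km].
  have : forall d, (k.+2 + d <= m)%N -> v k.+2 <= v (k.+2 + d)%N.
    elim=> [|d IH]; first by rewrite addn0.
    rewrite addnS => dm; apply: le_trans (IH (ltnW dm)) _; apply: ltW.
    by have /andP[] := vS _ dm.
  by move=> /(_ (m - k.+2)%N); rewrite subnKC ?(ltnW km) //; apply.
have v0k : v 0%N < v k.+1 by apply: inc; rewrite /= ltnW.
have Sk := Sv k.+1 (ltnW km); have Sk1 := Sv k.+2 km; have S0 := Sv 0%N isT.
have [e|ne] := eqVneq (v k.+1) (v 0%N + pi).
  apply: (convex_hull0_comb S0 S0 Sk (a := 1) (b := 0) (c := 1)) => //.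
  by rewrite e bdDpi; vec.
have lt : v k.+1 < v 0%N + pi by rewrite lt_neqAle ne.
have dS s t : s <= t <= s + pi -> 0 <= det2 (bd N s) (bd N t).
  move=> st; have := @det2_bd_le0 _ N s (t + pi).
  by rewrite bdDpi det2Nr oppr_le0; apply; lra.
apply: (convex_hull0_comb S0 Sk Sk1 (a := det2 (bd N (v k.+1)) (bd N (v k.+2)))
  (b := det2 (bd N (v k.+2)) (bd N (v 0%N)))
  (c := det2 (bd N (v 0%N)) (bd N (v k.+1)))).
- by apply: dS; lra.
- by rewrite det2C oppr_ge0; apply: det2_bd_le0; lra.
- by apply: det2_bd_gt0; lra.
- by apply: planeP; rewrite /det2 !mxE; ring.
Qed.
Lemma three_ordered (A : set R) : infinite_set A -> exists x y z : R,
  [/\ A x, A y & A z] /\ x < y < z.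
Proof.
move=> infA; have [x Ax] := infinite_setN0 infA.
have infx : infinite_set (A `\ x) by apply: infinite_setD => //; exact: finite_set1.
have [y [Ay yx]] := infinite_setN0 infx.
have infy : infinite_set (A `\ x `\ y) by apply: infinite_setD => //; exact: finite_set1.
have [z [[Az zx] zy]] := infinite_setN0 infy.
case: (ltgtP x y) => xy; last by case: yx.
- case: (ltgtP y z) => yz; last by case: zy.
  + by exists x, y, z; rewrite xy yz.
  + case: (ltgtP x z) => xz; last by case: zx.
      by exists x, z, y; rewrite xz yz.
    by exists z, x, y; rewrite xz xy.
- case: (ltgtP x z) => xz; last by case: zx.
  + by exists y, x, z; rewrite xy xz.
  + case: (ltgtP y z) => yz; last by case: zy.
      by exists y, z, x; rewrite yz xz.
    by exists z, y, x; rewrite yz xy.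
Qed.

End hull.

(** * Families for a predicate [P] on distances that covers the weak and the strict case *)

Section families.
Local Open Scope card_scope.
Context {R : realType}.
Local Notation plane := 'rV[R]_2.
Variable N : plane_norm R.
Variable P : R -> Prop.
Hypothesis P_mono : forall d d', d <= d' -> P d' -> P d.
Hypothesis P_lt1 : forall d, d < 1 -> P d.
Hypothesis P_le1 : forall d, P d -> d <= 1.
Implicit Types (S T : set plane) (x y z w : plane) (a b c e : R).

Definition family S :=
  [/\ forall x, S x -> N x = 1, forall x y, consecutive S x y -> P (N (x - y))
    & convex_hull S 0].

Lemma between_bd a y z : N y = 1 -> N z = 1 ->
  cyclically_between (bd N a) z y <->
  exists b c, [/\ a < b < c, c < a + 2 * pi, z = bd N b & y = bd N c].
Proof.
move=> y1 z1.
have rot s : rotation s (bd N a) = (N (dir a))^-1 *: dir (a + s).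
  by rewrite /bd rotationZ rotation_dir.
have p0 := @bd_scale_gt0 _ N.
split=> [[s [t [k [l [st t2 k0 l0 [zE yE]]]]]]|[b [c [abc ca zE yE]]]].
  rewrite rot scalerA in zE; rewrite rot scalerA in yE.
  exists (a + s), (a + t); split; [lra|lra| |].
    by rewrite zE (@bd_dir _ N) -?zE // mulr_gt0.
  by rewrite yE (@bd_dir _ N) -?yE // mulr_gt0.
exists (b - a), (c - a), ((N (dir b))^-1 * N (dir a)), ((N (dir c))^-1 * N (dir a)).
have N0 e : 0 < N (dir e) by rewrite nrm_gt0 // dir_neq0.
split; [lra|lra|by rewrite mulr_gt0|by rewrite mulr_gt0|].
by rewrite zE yE !rot !subrKC !scalerA -!mulrA !mulfV ?gt_eqF // !mulr1.
Qed.

(** * From cyclic sequences to minimal families *)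

Section realize.
Variables (n : nat) (u : nat -> R).
Hypothesis uP : cyc_seq N P n u.

Let uT := cyc_turn uP.

Definition vertices : set plane := [set bd N (u i) | i in `I_n].

Lemma verticesP x : vertices x <-> exists i, x = bd N (u i).
Proof.
split=> [[i _ <-]|[i ->]]; first by exists i.
by exists (i %% n)%N; rewrite ?bd_mod //= ltn_mod (turn_n_gt0 uT).
Qed.

Lemma vertices_unit x : vertices x -> N x = 1.
Proof. by move=> [i _ <-]; exact: bd_unit. Qed.

Lemma vertices_card : vertices #= `I_n.
Proof.
apply: inj_card_eq => i j /set_mem i0 /set_mem j0 e.
exact: (bd_mod_inj uT i0 j0 e).
Qed.

Lemma cyc_gap1 i : u i.+1 <= u i + pi.
Proof. by case: uP => inc _ gap _ _; have := gap i; have := inc i.+1; lra. Qed.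

Lemma vertices_family : family vertices.
Proof.
have [inc per gap near _] := uP; split; first exact: vertices_unit.
  move=> x y [/verticesP[i xE] Sy xy noz].
  have y1 := vertices_unit Sy; have [j yE] := (verticesP y).1 Sy.
  have [c ic yc] := unit_bd (u i) y1.
  have [k ik kE] := lift_angle uT ic (etrans (esym yc) yE).
  have k1 : (i.+1 <= k)%N.
    move: ik; rewrite leq_eqVlt => /predU1P[e|//]; case/eqP: xy.
    by rewrite xE yc -kE e.
  have [e|lt1] : k = i.+1 \/ (i.+1 < k)%N.
    by move: k1; rewrite leq_eqVlt => /predU1P[]; [left|right].
    by rewrite xE yc -kE e; exact: near.
  case: (noz (bd N (u i.+1))); first by apply/verticesP; exists i.+1.
  rewrite xE; apply/between_bd => //; first exact: bd_unit.
  exists (u i.+1), (u k); split => //; last by rewrite kE.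
    by rewrite inc (turn_lt uT).
  by rewrite kE; case/andP: ic.
apply: (@hull_small_gaps _ N _ u n).
- by move=> j _; rewrite inc cyc_gap1.
- by rewrite -per.
- by move=> j _; apply/verticesP; exists j.
Qed.

(** The nearest remaining points [u j] and [u k] around the missing [u i] are consecutive in [T],
    and at most a half turn apart because of the hull. Their chord is then at least the double step
    around [u i], which violates [P]. *)
Lemma sub_family_contra T i : T `<=` vertices -> ~ T (bd N (u i)) -> family T -> False.
Proof.
(* Shifting by a turn leaves room for the indices [k - n] and [i.-1] below [i]. *)
wlog ni : i / (n <= i)%N.
  move=> H TS Ti; apply: (H (i + n)%N) => //; first exact: leq_addl.
  by rewrite (turn_per uT) bdD2pi.
move=> TS Ti [T1 Tnear Thull]; have [inc per gap near far] := uP.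
have lift k b : u k <= b < u k + 2 * pi -> T (bd N b) -> exists2 j, (k <= j)%N & u j = b.
  by move=> kb /TS/verticesP[j]; exact: lift_angle.
have [||b ib Tb] := @hull_no_big_gap _ N T (u i) (u i + 2 * pi) T1 Thull.
  have := @pi_gt0 R; lra.
  by [].
have [k0 ik0 k0E] : exists2 j, (i <= j)%N & u j = b by apply: lift => //; lra.
have exk : exists k, (i < k)%N && `[< T (bd N (u k)) >].
  by exists k0; rewrite (turn_ltE uT) ?k0E; [exact/asboolP|lra].
case: (ex_minnP exk) => k /andP[ik /asboolP Tk] kmin.
have kn : (k <= i + n)%N.
  have : (k <= k0)%N.
    by apply: kmin; rewrite (turn_ltE uT) ?k0E; [exact/asboolP|lra].
  move/leq_trans; apply; apply/ltnW/(turn_ltE uT); rewrite k0E per; lra.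
have nk : (n <= k)%N by rewrite (leq_trans ni) // ltnW.
have Tkn : T (bd N (u (k - n)%N)).
  by rewrite -bdD2pi -per subnK.
have exj : exists j, (j < i)%N && `[< T (bd N (u j)) >].
  exists (k - n)%N; rewrite asboolT // andbT -(ltn_add2r n) subnK //.
  rewrite ltn_neqAle kn andbT; apply/eqP => e; apply: Ti.
  by rewrite -(_ : bd N (u k) = bd N (u i)) // e per bdD2pi.
have ubj : forall j, (j < i)%N && `[< T (bd N (u j)) >] -> (j <= i)%N.
  by move=> j /andP[/ltnW].
case: (ex_maxnP exj ubj) => j /andP[ji /asboolP Tj] jmax.
have noT l : (j < l)%N -> (l < k)%N -> ~ T (bd N (u l)).
  move=> jl lk Tl; case: (ltngtP l i) => li.
  - by have := jmax l; rewrite li asboolT // => /(_ isT); rewrite leqNgt jl.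
  - by have := kmin l; rewrite li asboolT // => /(_ isT); rewrite leqNgt lk.
  - by apply: Ti; rewrite -li.
have jk : u k <= u j + pi.
  rewrite leNgt; apply/negP => jk.
  have c1 : u j + pi < Num.min (u k) (u j + 2 * pi).
    by rewrite lt_min jk; have := @pi_gt0 R; lra.
  have c2 : Num.min (u k) (u j + 2 * pi) <= u j + 2 * pi by rewrite ge_min lexx orbT.
  have [c jc Tc] := hull_no_big_gap T1 Thull c1 c2.
  have [l jl lE] : exists2 l, (j <= l)%N & u l = c.
    by apply: lift => //; move: jc; rewrite lt_min; lra.
  move: jc; rewrite lt_min => /and3P[jc ck _].
  apply: (noT l); last by rewrite lE.
    by apply: (turn_ltE uT); rewrite lE.
  by apply: (turn_ltE uT); rewrite lE.
have ujk : u j < u k by apply: (turn_lt uT); exact: ltn_trans ik.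
have pi0 := @pi_gt0 R.
have : consecutive T (bd N (u j)) (bd N (u k)).
  split => //.
    apply/eqP => e; have e' : u j = u k by apply: (bd_inj _ e); lra.
    by rewrite e' ltxx in ujk.
  move=> z Tz /between_bd[||b' [c' [bc' cj zE kE]]].
  - exact: bd_unit.
  - exact: T1.
  have c'E : c' = u k.
    have [h|h] := leP c' (u k); first by apply: (bd_inj _ (esym kE)); lra.
    by apply/esym/(bd_inj _ kE); lra.
  have [l jl lE] : exists2 l, (j <= l)%N & u l = b'.
    by apply: lift; [lra|rewrite -zE].
  apply: (noT l); last by rewrite lE -zE.
    by apply: (turn_ltE uT); rewrite lE; lra.
  by apply: (turn_ltE uT); rewrite lE -c'E; lra.
move=> /Tnear; rewrite -/(dist N (u j) (u k)) => Pjk.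
have i0 : (0 < i)%N by apply: leq_trans ji.
apply: (far i.-1); apply: P_mono Pjk; rewrite (prednK i0).
apply: dist_nest.
  apply/andP; split; apply: (turn_le uT); first by rewrite -ltnS prednK.
  exact: leq_trans (leq_pred i) (leqnSn i).
rewrite jk andbT; exact: (turn_le uT).
Qed.

Lemma vertices_minimal : minimal_family family vertices.
Proof.
split; first exact: vertices_family.
move=> T [TS nST] FT; apply: nST => x Sx; apply: contrapT => Tx.
have [i xE] := (verticesP x).1 Sx; rewrite xE in Tx.
exact: (sub_family_contra TS Tx FT).
Qed.
End realize.

(** Past [a + pi], the vector [- bd N c] would lie between [bd N a] and [bd N b]. The sum and the
    difference of these two have norm at most 1, so the norm is the maximum norm in their basis, and
    [bd N b - bd N c] has a coordinate [1 + be > 1]. *)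
Lemma two_short_steps a b c : a < b < c -> b <= a + pi -> c <= b + pi ->
  dist N a b <= 1 -> dist N b c <= 1 -> c <= a + pi.
Proof.
move=> abc ba cb dab dbc; rewrite leNgt; apply/negP => ac.
have ba' : b < a + pi.
  by rewrite lt_neqAle ba andbT; apply/eqP => e; move: dab; rewrite e distDpi; lra.
have cb' : c < b + pi.
  by rewrite lt_neqAle cb andbT; apply/eqP => e; move: dbc; rewrite e distDpi; lra.
have dba : dist N b (a + pi) <= 1.
  by apply: le_trans dbc; apply: dist_mono_r; lra.
have [||al [be [al0 be0 cE]]] := @bd_cone _ N a (c - pi) b; [lra|lra|].
have nE := @square_norm _ N (bd N a) (bd N b) (bd_unit N a) (bd_unit N b) _ dab.
have {}nE := nE _ al (1 + be); move: dba dbc nE.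
rewrite bdBpi in cE.
have -> : dist N b c = N (al *: bd N a + (1 + be) *: bd N b).
  rewrite /dist -[bd N c]opprK cE; congr (N _); vec.
rewrite /dist bdDpi opprK addrC => h1 h2 /(_ h1) h3.
move: h2; rewrite h3 ge_max => /andP[_]; rewrite ger0_norm; lra.
Qed.

(** * From minimal families to cyclic sequences *)

Section analyze.
Variable S : set plane.
Hypothesis S_min : minimal_family family S.

Let S_unit x : S x -> N x = 1. Proof. by case: S_min => -[h _ _] _; exact: h. Qed.
Let S_near x y : consecutive S x y -> P (N (x - y)).
Proof. by case: S_min => -[_ h _] _; exact: h. Qed.
Let S_hull : convex_hull S 0. Proof. by case: S_min => -[_ _ h] _. Qed.

(** Since the hull condition survives, minimality makes some consecutive pair of the smaller set
    violate [P]. That pair was not consecutive in [S], so the removed point is the only one between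
    its members. *)
Lemma removal b : S (bd N b) -> convex_hull (S `\ bd N b) 0 -> exists a c,
  [/\ a < b < c, c < a + 2 * pi, S (bd N a) & S (bd N c)] /\
  (~ P (dist N a c) /\ forall e, a < e < c -> S (bd N e) -> e = b).
Proof.
move=> Sb hullb; have [_ /(_ (S `\ bd N b)) nF] := S_min.
have : exists x y, consecutive (S `\ bd N b) x y /\ ~ P (N (x - y)).
  apply: contrapT => no; apply: nF.
    split; first by move=> x [].
    by move=> /(_ _ Sb)[_]; apply.
  split => //; first by move=> x [/S_unit].
  move=> x y xy; apply: contrapT => nP; apply: no; by exists x, y.
move=> [x [y [[[Sx xb] [Sy yb] xy noz] nP]]].
have [z [Sz zxy]] : exists z, S z /\ cyclically_between x z y.
  apply: contrapT => no; apply: nP; apply: S_near; split => // z Sz zb.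
  by apply: no; exists z.
have zb : z = bd N b.
  by apply: contrapT => zb; apply: (noz z).
rewrite zb in zxy.
have [a ab xE] := unit_bd (b - 2 * pi) (S_unit Sx).
rewrite xE in zxy Sx xb noz xy nP.
have [b' [c [abc ca bE yE]]] := (between_bd _ (S_unit Sy) (bd_unit N b)).1 zxy.
have ab2 : b - 2 * pi != a.
  by apply/eqP => e; apply: xb; rewrite -e /= -(bdD2pi N (b - _)) subrK.
have ab' : b - 2 * pi < a by rewrite lt_neqAle ab2; case/andP: ab.
have bb : b' = b.
  have [h|h] := leP b' b; first by apply: (bd_inj _ (esym bE)); lra.
  by apply/esym/(bd_inj _ bE); lra.
rewrite bb in abc; rewrite yE in Sy nP noz.
exists a, c; do 2 split => //.
move=> e ae Se; apply: contrapT => eb; apply: (noz (bd N e)); last first.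
  apply/between_bd; rewrite ?bd_unit //; exists e, c; split => //; lra.
split => //= ee; apply: eb.
have [h|h] := leP e b; first by apply: (bd_inj _ ee); lra.
by apply/esym/(bd_inj _ (esym ee)); lra.
Qed.

(* Every point outside a finite set spanning 0 has two neighbours at distance at
   least 1 from each other, so such points cannot accumulate. *)
Lemma minimal_finite : finite_set S.
Proof.
apply: contrapT => infS.
have [T [TS fT Thull]] := convex_hull_finite S_hull.
pose A : set R := [set b | [/\ 0 <= b < 2 * pi, S (bd N b) & ~ T (bd N b)]].
have infA : infinite_set A.
  move=> fA; apply: infS.
  apply: (@sub_finite_set _ _ (T `|` bd N @` A)); last first.
    by rewrite finite_setU; split => //; exact: finite_image.
  move=> x Sx; have [Tx|nTx] := pselect (T x); [by left|right].
  have [b b2 xE] := unit_bd 0 (S_unit Sx).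
  by exists b; rewrite -?xE // /A /= -xE; split => //; rewrite add0r in b2.
have bndA : bounded_set A.
  exists (2 * pi); split; first exact: num_real.
  move=> r hr b [b2 _ _] /=; rewrite ler_norml; lra.
have [l /limit_point_infinite_setP lA] := infinite_bounded_limit_point_nonempty infA bndA.
(* Radius 1/2, so that any two points near [l] are less than 1 apart. *)
have [d /= d0 dl] : exists2 d : R, 0 < d & forall e, `|l - e| < d -> dist N e l < 2^-1.
  have h : \forall e \near l, dist N e l < 2^-1.
    have cv : dist N e l @[e --> l] --> dist N l l by exact: dist_continuous.
    by apply: (cvgr_lt _ cv); rewrite distxx invr_gt0.
  by move/nbhs_ballP: h => [d /= d0 h]; exists d => // e el; apply: h.
have [x [y [z [[xA yA zA] xyz]]]] := three_ordered (lA _ (nbhsx_ballx l d d0)).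
move: xA yA zA; rewrite /ball /= => -[xl [_ Sx _]] [yl [_ Sy Ty]] [zl [_ Sz _]].
have hy : convex_hull (S `\ bd N y) 0.
  apply: convex_hullS Thull => v Tv; split; first exact: TS.
  by move=> /= vE; apply: Ty; rewrite -vE.
have [a [c [[ayc ca _ _] [nP onlyb]]]] := removal Sy hy.
have ax : x <= a.
  rewrite leNgt; apply/negP => h.
  have xE : x = y by apply: onlyb => //; lra.
  by move: xyz; rewrite xE ltxx.
have cz : c <= z.
  rewrite leNgt; apply/negP => h.
  have zE : z = y by apply: onlyb => //; lra.
  by move: xyz; rewrite zE ltxx andbF.
apply: nP; apply: P_lt1.
have hn e : x <= e <= z -> `|l - e| < d by move: xl zl; rewrite !ltr_norml; lra.
have da : dist N a l < 2^-1 by apply/dl/hn; lra.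
have dc : dist N c l < 2^-1 by apply/dl/hn; lra.
rewrite /dist (_ : bd N a - bd N c = (bd N a - bd N l) + - (bd N c - bd N l)); last by vec.
by apply: le_lt_trans (nrm_add _ _ _) _; rewrite nrmN -!/(dist _ _ _); lra.
Qed.

Lemma minimal_turn : exists n (u : nat -> R),
  turn n u /\ forall x, S x <-> exists i, x = bd N (u i).
Proof.
have /choice[ang angP] : forall x, exists b, S x -> 0 <= b < 2 * pi /\ x = bd N b.
  move=> x; have [Sx|nSx] := pselect (S x); last by exists 0.
  by have [b b2 xE] := unit_bd 0 (S_unit Sx); exists b; rewrite add0r in b2.
have [s0 s0E] := (finite_seqP _).1 (finite_image ang minimal_finite).
pose s := sort <=%O (undup s0); pose n := size s.
have sP b : b \in s <-> exists2 x, S x & ang x = b.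
  rewrite mem_sort mem_undup; split=> [bs|[x Sx <-]].
    have : [set` s0] b by [].
    by rewrite -s0E.
  have : (ang @` S) (ang x) by exists x.
  by rewrite s0E.
have s2 b : b \in s -> 0 <= b < 2 * pi by move=> /sP[x /angP[? _] <-].
have ss : sorted <%O s by rewrite sort_lt_sorted undup_uniq.
have n0 : (0 < n)%N.
  have pi0 := @pi_gt0 R.
  have [||b _ Sb] := @hull_no_big_gap _ N S 0 (2 * pi) S_unit S_hull; [lra|lra|].
  rewrite lt0n; apply/eqP => /size0nil se.
  by have : ang (bd N b) \in s; [apply/sP; exists (bd N b)|rewrite se].
pose u i := nth 0 s (i %% n) + (i %/ n)%:R * (2 * pi).
have us i : (i < n)%N -> u i = nth 0 s i.
  by move=> im; rewrite /u modn_small // divn_small // mul0r addr0.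
have un i : u (i + n)%N = u i + 2 * pi.
  by rewrite /u modnDr divnDr // divnn n0 addn1 -natr1; ring.
have uT : turn n u.
  split => //; apply: (periodic_ind n0) => i; last by rewrite -addSn !un ltrD2r.
  move=> im; rewrite (us i) //; have : (i.+1 <= n)%N := im.
  rewrite leq_eqVlt => /predU1P[e|im1].
    rewrite e -[n]add0n un us //; have := s2 _ (mem_nth 0 im); have := s2 _ (mem_nth 0 n0).
    lra.
  by rewrite us //; apply: (sorted_ltn_nth lt_trans 0 ss).
exists n, u; split => // x; split=> [Sx|[i ->]].
  have [b2 xE] := angP x Sx.
  have xs : ang x \in s by apply/sP; exists x.
  by exists (index (ang x) s); rewrite us ?nth_index // index_mem.
rewrite -(bd_mod N uT) us ?ltn_mod //.
have /sP[y Sy <-] := mem_nth 0 (ltn_pmod i n0).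
by have [_ <-] := angP y Sy.
Qed.

Lemma minimal_cyc_seq : exists n u, cyc_seq N P n u /\ S #= `I_n.
Proof.
have [n [u [uT SP]]] := minimal_turn; have [inc per] := uT.
have n0 := turn_n_gt0 uT; have pi0 := @pi_gt0 R.
have Su i : S (bd N (u i)) by apply/SP; exists i.
have lift k b : u k <= b < u k + 2 * pi -> S (bd N b) -> exists2 j, (k <= j)%N & u j = b.
  by move=> kb /SP[j]; exact: lift_angle.
have gap1 i : u i.+1 <= u i + pi.
  rewrite leNgt; apply/negP => gi.
  have in2 : u i.+1 <= u i + 2 * pi by rewrite -per (turn_le uT) // -addn1 leq_add2l.
  have [b ib Sb] := hull_no_big_gap S_unit S_hull gi in2.
  have [|l il lE] := lift i b _ Sb; first by lra.
  have : (i < l)%N by apply: (turn_ltE uT); rewrite lE; lra.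
  by rewrite leqNgt (turn_ltE uT) // lE; case/andP: ib.
have near i : P (dist N (u i) (u i.+1)).
  have g := gap1 i; have ii := inc i.
  apply: S_near; split => //.
    apply/eqP => e; have e' : u i = u i.+1 by apply: (bd_inj _ e); lra.
    by rewrite e' ltxx in ii.
  move=> z Sz /between_bd[||b [c [ibc ci zE cE]]]; try exact: bd_unit.
    exact: S_unit.
  have cE' : c = u i.+1.
    have [h|h] := leP c (u i.+1); first by apply: (bd_inj _ (esym cE)); lra.
    by apply/esym/(bd_inj _ cE); lra.
  have [||l il lE] := lift i b; [lra|by rewrite -zE|].
  have : (i < l)%N by apply: (turn_ltE uT); rewrite lE; lra.
  by rewrite leqNgt (turn_ltE uT) // lE -cE'; case/andP: ibc.
have gap2 i : u i.+2 <= u i + pi.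
  apply: (@two_short_steps (u i) (u i.+1)) => //; first by rewrite !inc.
    exact/P_le1/near.
  exact/P_le1/near.
have n2 : (2 < n)%N.
  have := gap2 0%N; have := per 0%N; rewrite add0n => h1 h2.
  by apply: (turn_ltE uT); lra.
have neq k l : (k < l)%N -> (l < k + n)%N -> bd N (u k) <> bd N (u l).
  move=> kl ln e; have h := turn_lt uT kl.
  have e' : u k = u l by apply: (bd_inj _ e); rewrite -per (turn_lt uT) // ltW.
  by rewrite e' ltxx in h.
have far i : ~ P (dist N (u i) (u i.+2)).
  move=> Pd; pose I := (i.+1 + n)%N.
  have hullI : convex_hull (S `\ bd N (u I)) 0.
    (* One turn from [u i.+2] without [u I]: the extra 1 at the last index jumps from [i + n] to
       [i.+2 + n], a gap bounded by [gap2]. *)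
    pose v j := u (i.+2 + j + (j == n.-1))%N.
    apply: (@hull_small_gaps _ N _ v n.-1).
    - move=> j jn; rewrite /v (ltn_eqF jn) addn0.
      have : (j.+1 <= n.-1)%N := jn.
      rewrite leq_eqVlt => /predU1P[e|jn1].
        by rewrite -e eqxx addn1 addnS (turn_lt uT) //=; exact: gap2.
      by rewrite (ltn_eqF jn1) addn0 addnS inc gap1.
    - rewrite /v eqxx addn1 -addnS prednK // per addn0.
      by rewrite eq_sym gtn_eqF ?addn0 // -subn1 subn_gt0 (leq_ltn_trans _ n2).
    - move=> j jn; split; first exact: Su.
      rewrite /v /=; move: jn; rewrite leq_eqVlt => /predU1P[->|jn].
        rewrite eqxx addn1 -addnS prednK // => e.
        apply: (neq I (i.+2 + n)%N) (esym e); rewrite /I ?ltn_add2r //.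
        by rewrite -[X in (X < _)%N]addn1 ltn_add2l (ltn_trans _ n2).
      rewrite (ltn_eqF jn) addn0; apply: neq; rewrite /I.
        by rewrite addSnnS ltn_add2l -(prednK n0) ltnS.
      by rewrite ltn_add2r ltnS leq_addr.
  have [a [c [[aIc ca Sa Sc] [nP only]]]] := removal (Su I) hullI.
  apply: nP.
  have uI : u I = u i.+1 + 2 * pi by rewrite per.
  have [|l il lE] := lift i.+1 a _ Sa; first by lra.
  have [|m Im mE] := lift I c _ Sc; first by lra.
  have lI : (l < I)%N by apply: (turn_ltE uT); rewrite lE; lra.
  have Im' : (I < m)%N by apply: (turn_ltE uT); rewrite mE; lra.
  have lE' : l = (i + n)%N.
    apply/eqP; rewrite eqn_leq -ltnS -addSn lI /= leqNgt; apply/negP => li.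
    have : u (i + n)%N = u I.
      by apply: only => //; rewrite -lE -mE !(turn_lt uT).
    by apply/eqP; rewrite lt_eqF // (turn_lt uT) // /I addSn.
  have mE' : m = (i.+2 + n)%N.
    apply/eqP; rewrite eqn_leq addSn Im' andbT leqNgt; apply/negP => mi.
    have : u I.+1 = u I.
      apply: only => //; rewrite -lE -mE !(turn_lt uT) //.
      by rewrite (ltn_trans lI).
    by apply/eqP; rewrite gt_eqF // inc.
  by rewrite -lE -mE lE' mE' !per dist_2pi.
have uP : cyc_seq N P n u by split.
exists n, u; split => //.
have -> : S = vertices n u by apply/seteqP; split=> x; [move=> /SP /(verticesP uP)|move=> /(verticesP uP) /SP].
exact: vertices_card uP.
Qed.
End analyze.

Lemma max_card_family n u : cyc_seq N P n u -> (forall m v, cyc_seq N P m v -> (m <= n)%N) ->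
  Defs.max_card (minimal_family family) n.
Proof.
move=> uP le_n; split.
  by exists (vertices n u); [exact: vertices_minimal|exact: vertices_card uP].
move=> S /minimal_cyc_seq[m [v [vP Sm]]].
by rewrite (card_le_eql Sm) card_le_II (le_n m v).
Qed.
End families.

(** * Touching translates and the norm with unit ball C - C *)

Section gauge.
Context {R : realType}.
Local Notation plane := 'rV[R]_2.
Variable C : set plane.
Hypothesis C_disc : convex_disc C.
Implicit Types (x y z v w : plane) (a b c d e r s : R).

Let C_conv : forall x y c, 0 <= c <= 1 -> C x -> C y -> C (c *: x + (1 - c) *: y).
Proof. by case: C_disc => _ /convex_setP. Qed.

Lemma interior_ballP (A : set plane) x :
  interior A x <-> exists2 e : R, 0 < e & forall v, `|v| < e -> A (x + v).
Proof.
split.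
  move=> /nbhs_normP[e /= e0 h]; exists e => // v ve.
  by apply: h; rewrite /ball_ /= opprD addNKr normrN.
move=> [e e0 h]; have [_] := nbhs_normP x A; apply.
exists e => //= y; rewrite /ball_ /= => ye.
by rewrite -[y](subrKC x); apply: h; rewrite distrC.
Qed.

Definition scaled_difference x r := 0 < r /\
  exists p q, [/\ C p, C q & x = r *: (p - q)].

(* The unit ball is [C - C], not half of it, so that the translates touching [C]
   are those by unit vectors. *)
Definition gauge x := inf (scaled_difference x).

Let sd_ge0 x : lbound (scaled_difference x) 0.
Proof. by move=> r [/ltW]. Qed.

Let sd_lb x : has_lbound (scaled_difference x).
Proof. by exists 0. Qed.

Lemma scaled_difference_le x r s : scaled_difference x r -> r <= s -> scaled_difference x s.
Proof.
move=> [r0 [p [q [Cp Cq xE]]]] rs; have s0 : 0 < s by lra.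
split => //; exists ((r / s) *: p + (1 - r / s) *: q), q.
have rs01 : 0 <= r / s <= 1.
  by rewrite divr_ge0 ?(ltW r0) ?(ltW s0) //= ler_pdivrMr // mul1r.
split => //; first exact: C_conv.
by rewrite xE; apply/rowP => i; rewrite !mxE; field; rewrite gt_eqF.
Qed.

Lemma scaled_difference_nonempty x : scaled_difference x !=set0.
Proof.
have [_ _ [z0 /interior_ballP[e e0 oe]]] := C_disc.
have x0 : 0 < `|x| + 1 by rewrite ltr_wpDl.
exists ((`|x| + 1) / e); split; first by rewrite divr_gt0.
exists (z0 + (e / (`|x| + 1)) *: x), z0; split.
- apply: oe; rewrite normrZ gtr0_norm ?divr_gt0 // -mulrA gtr_pMr //.
  by rewrite mulrC ltr_pdivrMr // mul1r ltrDl.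
- by rewrite -[z0]addr0; apply: oe; rewrite normr0.
- apply/rowP => i; rewrite !mxE; field; rewrite !gt_eqF //.
Qed.

Let sd_inf x : has_inf (scaled_difference x).
Proof. by split => //; exact: scaled_difference_nonempty. Qed.

Lemma gauge_ge0 x : 0 <= gauge x.
Proof. apply: lb_le_inf => //; exact: scaled_difference_nonempty. Qed.

Lemma gauge_lt x r : gauge x < r -> scaled_difference x r.
Proof.
move=> xr; have e0 : 0 < r - gauge x by lra.
have [s xs sr] := inf_adherent e0 (sd_inf x).
apply: (scaled_difference_le xs); rewrite -/(gauge x) in sr; lra.
Qed.

Lemma gauge_le x r : scaled_difference x r -> gauge x <= r.
Proof. by move=> xr; apply: ge_inf. Qed.

Lemma gauge_add x y : gauge (x + y) <= gauge x + gauge y.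
Proof.
apply/ler_addgt0Pr => e e0.
pose r : R := gauge x + e / 2; pose s : R := gauge y + e / 2.
have [r0 [p [q [Cp Cq xE]]]] : scaled_difference x r by apply: gauge_lt; rewrite /r; lra.
have [s0 [p' [q' [Cp' Cq' yE]]]] : scaled_difference y s by apply: gauge_lt; rewrite /s; lra.
have -> : gauge x + gauge y + e = r + s by rewrite /r /s; lra.
clearbody r s; have rs0 : 0 < r + s by exact: addr_gt0.
apply: gauge_le; split => //.
have k01 : 0 <= r / (r + s) <= 1.
  by rewrite divr_ge0 ?(ltW r0) ?(ltW rs0) //= ler_pdivrMr // mul1r lerDl ltW.
exists ((r / (r + s)) *: p + (1 - r / (r + s)) *: p'),
  ((r / (r + s)) *: q + (1 - r / (r + s)) *: q'); split; try exact: C_conv.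
rewrite xE yE; apply/rowP => i; rewrite !mxE; field; rewrite gt_eqF //.
Qed.

Lemma gauge_scale_le a x : 0 < a -> gauge (a *: x) <= a * gauge x.
Proof.
move=> a0; apply/ler_addgt0Pr => e e0.
have [|r0 [p [q [Cp Cq xE]]]] := @gauge_lt x (gauge x + e / a).
  by rewrite ltrDl divr_gt0.
apply: gauge_le; split; first by rewrite ltr_wpDl // mulr_ge0 ?gauge_ge0 // ltW.
exists p, q; split => //; rewrite {1}xE scalerA; congr (_ *: _).
by field; rewrite gt_eqF.
Qed.

Lemma gaugeN x : gauge (- x) = gauge x.
Proof.
suff H y : gauge (- y) <= gauge y.
  by apply/eqP; rewrite eq_le H -{1}[x]opprK H.
apply/ler_addgt0Pr => e e0.
have [|r0 [p [q [Cp Cq xE]]]] := @gauge_lt y (gauge y + e); first by lra.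
by apply: gauge_le; split => //; exists q, p; split => //; rewrite {1}xE; vec.
Qed.

Lemma gauge0 : gauge 0 = 0.
Proof.
apply/eqP; rewrite eq_le gauge_ge0 andbT; apply/ler_addgt0Pr => e e0.
have [_ _ [z0 /interior_subset Co]] := C_disc.
rewrite add0r; apply: gauge_le; split => //; exists z0, z0; split => //.
by rewrite subrr scaler0.
Qed.

Lemma gauge_scale a x : gauge (a *: x) = `|a| * gauge x.
Proof.
wlog a0 : a x / 0 <= a.
  move=> H; have [a0|a0] := leP 0 a; first exact: H.
  by rewrite -[a]opprK scaleNr gaugeN normrN H //; lra.
rewrite ger0_norm //; move: a0; rewrite le_eqVlt => /predU1P[<-|a0].
  by rewrite scale0r gauge0 mul0r.
apply/eqP; rewrite eq_le gauge_scale_le //= -ler_pdivlMl //.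
have := @gauge_scale_le a^-1 (a *: x); rewrite scalerA mulVf ?gt_eqF // scale1r.
by apply; rewrite invr_gt0.
Qed.

(** Boundedness of [C] makes the gauge definite. *)
Lemma gauge_bound : exists2 M, 0 < M & forall x, `|x| <= M * gauge x.
Proof.
have [/compact_bounded[M [Mr CM]] _ _] := C_disc.
have {CM} CM p : C p -> `|p| <= `|M| + 1.
  by apply: CM; rewrite (le_lt_trans (ler_norm M)) // ltrDl.
exists (2 * (`|M| + 1)); first by rewrite mulr_gt0 // ltr_wpDl.
move=> x; have M0 : 0 < 2 * (`|M| + 1) by rewrite mulr_gt0 // ltr_wpDl.
rewrite mulrC -ler_pdivrMr //; apply: lb_le_inf; first exact: scaled_difference_nonempty.
move=> r [r0 [p [q [/CM Cp /CM Cq ->]]]].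
rewrite ler_pdivrMr // normrZ gtr0_norm // ler_wpM2l ?(ltW r0) //.
by apply: le_trans (ler_normB _ _) _; lra.
Qed.

Lemma gauge_eq0 x : gauge x = 0 -> x = 0.
Proof.
have [M M0 /(_ x)] := gauge_bound => + x0; rewrite x0 mulr0.
by rewrite normr_le0 => /eqP.
Qed.

Definition disc_norm := PlaneNorm gauge_add gauge_scale gauge_eq0.

Lemma difference_closed : closed [set p - q | p in C & q in C].
Proof.
have [cptC _ _] := C_disc.
apply: compact_closed; first exact: norm_hausdorff.
have -> : [set p - q | p in C & q in C] = (fun z : plane * plane => z.1 - z.2) @` (C `*` C).
  apply/seteqP; split=> x.
    by move=> [p Cp [q Cq <-]]; exists (p, q).
  by move=> [[p q] [/= Cp Cq] <-]; exists p => //; exists q.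
apply: continuous_compact; last exact: compact_setX.
by apply: continuous_subspaceT => z; exact: sub_continuous.
Qed.

(** The infimum is attained: for every [d > 0] the vector [(1 + d)^-1 *: x] is a difference of
    points of [C], it tends to [x], and the set of differences is closed. *)
Lemma gauge_le1 x : gauge x <= 1 <-> exists p q, [/\ C p, C q & x = p - q].
Proof.
split=> [x1|[p [q [Cp Cq xE]]]]; last first.
  by apply: gauge_le; split => //; exists p, q; rewrite scale1r.
suff : [set p - q | p in C & q in C] x.
  by move=> [p Cp [q Cq <-]]; exists p, q.
apply: difference_closed => U /nbhs_normP[e /= e0 eU].
have x0 : 0 < `|x| + 1 by rewrite ltr_wpDl.
pose d := e / (`|x| + 1); have d0 : 0 < d by rewrite divr_gt0.
have [|_ [p [q [Cp Cq xE]]]] := @gauge_lt x (1 + d); first by lra.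
exists (p - q); split; first by exists p => //; exists q.
apply: eU; rewrite /ball_ /=.
have pq : p - q = (1 + d)^-1 *: x.
  by rewrite xE scalerA mulVf ?scale1r // gt_eqF //; lra.
have -> : x - (p - q) = (d / (1 + d)) *: x.
  rewrite pq; clearbody d.
  by apply/rowP => i; rewrite !mxE; field; rewrite gt_eqF // addr_gt0.
rewrite normrZ gtr0_norm; last by apply: divr_gt0 => //; exact: addr_gt0.
apply: (@le_lt_trans _ _ (d * `|x|)).
  apply: ler_wpM2r; first exact: normr_ge0.
  by rewrite ler_pdivrMr ?addr_gt0 // ler_peMr ?(ltW d0) //; lra.
by rewrite /d mulrAC ltr_pdivrMr // ltr_pM2l // ltrDl.
Qed.

Lemma interior_comb r p z0 : 0 <= r < 1 -> C p -> interior C z0 ->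
  interior C (r *: p + (1 - r) *: z0).
Proof.
move=> r01 Cp /interior_ballP[e e0 oe]; apply/interior_ballP.
have r1 : 0 < 1 - r by lra.
exists ((1 - r) * e); first exact: mulr_gt0.
move=> v ve.
have -> : r *: p + (1 - r) *: z0 + v = r *: p + (1 - r) *: (z0 + (1 - r)^-1 *: v).
  by rewrite scalerDr scalerA mulfV ?gt_eqF // scale1r addrA.
apply: C_conv; [lra|by []|apply: oe].
by rewrite normrZ gtr0_norm ?invr_gt0 // mulrC ltr_pdivrMr // mulrC.
Qed.

(** Forwards, contract [p] and [q] towards an interior point by a factor [r < 1]. Backwards, the
    room around [z + v] allows [v] to be lengthened to [(1 + d) *: v] as a difference of points of
    [C]. *)
Lemma gauge_lt1 v : gauge v < 1 <-> exists2 z, interior C z & interior C (z + v).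
Proof.
have [_ _ [z0 Co]] := C_disc; split=> [v1|[z Cz /interior_ballP[e e0 zve]]].
  pose r := (gauge v + 1) / 2.
  have [|r0 [p [q [Cp Cq vE]]]] := @gauge_lt v r; first by rewrite /r; lra.
  have r1 : r < 1 by rewrite /r; lra.
  exists (r *: q + (1 - r) *: z0); first by apply: interior_comb => //; rewrite ltW.
  have -> : r *: q + (1 - r) *: z0 + v = r *: p + (1 - r) *: z0.
    by rewrite [in LHS]vE; clearbody r; vec.
  by apply: interior_comb => //; rewrite ltW.
have v0 : 0 < `|v| + 1 by rewrite ltr_wpDl.
pose d := e / (`|v| + 1); have d0 : 0 < d by rewrite divr_gt0.
have : gauge ((1 + d) *: v) <= 1.
  apply/gauge_le1; exists (z + v + d *: v), z; split.
  - apply: zve; rewrite normrZ gtr0_norm // /d mulrAC ltr_pdivrMr // ltr_pM2l //.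
    by rewrite ltrDl.
  - exact: interior_subset Cz.
  - by vec.
rewrite gauge_scale gtr0_norm ?addr_gt0 // => h.
have d1 : 0 < 1 + d by lra.
by rewrite -(ltr_pM2l d1) mulr1 (le_lt_trans h) // ltrDl.
Qed.

Lemma interior_translate x z : interior (translate C x) z <-> interior C (z - x).
Proof.
split=> /interior_ballP[e e0 h]; apply/interior_ballP; exists e => // v /h.
  by move=> [c Cc cE]; rewrite addrAC -cE addrK.
by move=> Cv; exists (z - x + v) => //; rewrite addrAC subrK.
Qed.

Lemma overlap_translates x y :
  overlap (translate C x) (translate C y) <-> disc_norm (x - y) < 1.
Proof.
split.
  move=> [z [/interior_translate zx /interior_translate zy]]; apply/gauge_lt1.
  have e : z - x + (x - y) = z - y by vec.
  by exists (z - x); [exact: zx|rewrite e].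
move=> /gauge_lt1[z Cz Czv]; exists (z + x); split; apply/interior_translate.
  by rewrite addrK.
by rewrite -addrA.
Qed.

Lemma meet_translates x y :
  translate C x `&` translate C y !=set0 <-> disc_norm (x - y) <= 1.
Proof.
split=> [[z [[p Cp pE] [q Cq qE]]]|/gauge_le1[p [q [Cp Cq xyE]]]].
  apply/gauge_le1; exists q, p; split => //.
  by rewrite -[x](addKr p) -[y](addKr q) pE qE; vec.
exists (q + x); split; first by exists q.
by exists p => //; rewrite -[x](subrK y) xyE; vec.
Qed.

Lemma translate0 : translate C 0 = C.
Proof.
apply/seteqP; split=> x; first by move=> [z Cz <-]; rewrite addr0.
by move=> Cx; exists x => //; rewrite addr0.
Qed.

Lemma touch_translate x : touch (translate C x) C <-> disc_norm x = 1.
Proof.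
rewrite /touch -[in X in X <-> _]translate0.
have ht := overlap_translates x 0; have hm := meet_translates x 0.
rewrite subr0 translate0 in ht hm.
rewrite translate0; split=> [[/hm le1 nlt]|x1].
  by apply/eqP; rewrite eq_le le1 leNgt; apply/negP => /ht.
by split; [apply/hm; rewrite x1|move=> /ht; rewrite x1 ltxx].
Qed.

Lemma parallelogram_square : parallelogram C <-> square disc_norm.
Proof.
split.
  move=> [p [u [v [ind CE]]]].
  have inC a b : 0 <= a <= 1 -> 0 <= b <= 1 -> C (p + a *: u + b *: v).
    by move=> a01 b01; rewrite CE; exists a, b.
  have inD x a b a' b' : 0 <= a <= 1 -> 0 <= b <= 1 -> 0 <= a' <= 1 -> 0 <= b' <= 1 ->
     x = (a - a') *: u + (b - b') *: v -> gauge x <= 1.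
    move=> ha hb ha' hb' ->; apply/gauge_le1.
    exists (p + a *: u + b *: v), (p + a' *: u + b' *: v); split; try exact: inC.
    by vec.
  have ge1 x : (forall r, 0 < r -> forall a b, -1 <= a <= 1 -> -1 <= b <= 1 ->
      x = r *: (a *: u + b *: v) -> 1 <= r) -> 1 <= gauge x.
    move=> h; apply: lb_le_inf; first exact: scaled_difference_nonempty.
    move=> r [r0 [q [q' [+ + xE]]]].
    rewrite CE => -[a [b [a01 b01 qE]]] [a' [b' [a01' b01' qE']]].
    apply: (h r r0 (a - a') (b - b')); [lra|lra|].
    by rewrite xE qE qE'; congr (_ *: _); vec.
  exists u, v; split.
  - apply/eqP; rewrite eq_le; apply/andP; split.
      by apply: (@inD _ 1 0 0 0); rewrite ?lexx ?ler01 //; vec.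
    apply: ge1 => r r0 a b a1 b1 uE.
    have [|e _] := ind (1 - r * a) (- (r * b)).
      by rewrite scalerBl scale1r [in X in X - _]uE; vec.
    have : r * (1 - a) >= 0 by apply: mulr_ge0; lra.
    lra.
  - apply/eqP; rewrite eq_le; apply/andP; split.
      by apply: (@inD _ 0 1 0 0); rewrite ?lexx ?ler01 //; vec.
    apply: ge1 => r r0 a b a1 b1 vE.
    have [|_ e] := ind (- (r * a)) (1 - r * b).
      by rewrite scalerBl scale1r [in X in _ + (X - _)]vE; vec.
    have : r * (1 - b) >= 0 by apply: mulr_ge0; lra.
    lra.
  - by apply: (@inD _ 1 1 0 0); rewrite ?lexx ?ler01 //; vec.
  - by apply: (@inD _ 1 0 0 1); rewrite ?lexx ?ler01 //; vec.
move=> [t [w [t1 w1 pw mw]]]; have nE := square_norm t1 w1 pw mw.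
have ind a b : a *: t + b *: w = 0 -> a = 0 /\ b = 0.
  move=> e; have := nE a b; rewrite e nrm0 => /esym h.
  have ha : `|a| <= 0 by rewrite -h le_max lexx.
  have hb : `|b| <= 0 by rewrite -h le_max lexx orbT.
  by move: ha hb; rewrite !normr_le0 => /eqP -> /eqP ->.
have dtw : det2 t w != 0.
  apply/eqP => /(unit_parallel t1 w1)[] wE.
    have [|/eqP] := ind 1 (-1); first by rewrite wE; vec.
    by rewrite oner_eq0.
  have [|/eqP] := ind 1 1; first by rewrite wE; vec.
  by rewrite oner_eq0.
have [p1 [p0 [C1 C0 tw1]]] := (gauge_le1 _).1 pw.
have [p2 [p3 [C2 C3 tw2]]] := (gauge_le1 _).1 mw.
(* Comparing [q] with both ends of the diagonal from [p0] to [p1] confines its coordinates to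
   [[0, 1]]. *)
have box q : C q -> exists a b, [/\ 0 <= a <= 1, 0 <= b <= 1 & q = p0 + a *: t + b *: w].
  move=> Cq; have h0 : disc_norm (q - p0) <= 1 by apply/gauge_le1; exists q, p0.
  have h1 : disc_norm (q - p1) <= 1 by apply/gauge_le1; exists q, p1.
  move: (cramer_div (q - p0) dtw); set a := _ / _; set b := _ / _ => e.
  have e1 : q - p1 = (a - 1) *: t + (b - 1) *: w.
    have -> : q - p1 = (q - p0) - (p1 - p0) by vec.
    by rewrite e -tw1; vec.
  move: h0 h1; rewrite e e1 !nE !ge_max !ler_norml => h0 h1.
  exists a, b; split; [lra|lra|].
  by rewrite -addrA -e subrKC.
exists p0, t, w; split => //; apply/seteqP; split=> [z Cz|z [a [b [a01 b01 ->]]]].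
  exact: box.
have [a2 [b2 [a2i b2i p2E]]] := box _ C2; have [a3 [b3 [a3i b3i p3E]]] := box _ C3.
(* Two points of the box that differ by [t - w] can only be its other two corners, so [C] contains
   all four. *)
have [ea eb] : a2 - a3 - 1 = 0 /\ b2 - b3 + 1 = 0.
  apply: ind; have : (t - w) - (p2 - p3) = 0 by rewrite tw2 subrr.
  by rewrite p2E p3E => e; rewrite -[RHS]oppr0 -[in RHS]e; vec.
have p2E' : p2 = p0 + t.
  have -> : p2 = p0 + 1 *: t + 0 *: w by rewrite p2E; congr (_ + _ *: _ + _ *: _); lra.
  by vec.
have p3E' : p3 = p0 + w.
  have -> : p3 = p0 + 0 *: t + 1 *: w by rewrite p3E; congr (_ + _ *: _ + _ *: _); lra.
  by vec.
have p1E : p1 = p0 + t + w by rewrite -addrA tw1 subrKC.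
have -> : p0 + a *: t + b *: w = b *: (a *: p1 + (1 - a) *: p3) +
   (1 - b) *: (a *: p2 + (1 - a) *: p0).
  by rewrite p1E p2E' p3E'; vec.
by apply: C_conv => //; apply: C_conv.
Qed.

Lemma dual_hadwiger_family : dual_hadwiger C = family disc_norm (fun d => d <= 1).
Proof.
apply/funext => S; apply/propext; split=> -[h1 h2 h3]; split => //.
- by move=> x /h1/touch_translate.
- by move=> x y /h2/meet_translates.
- by move=> x /h1/touch_translate.
- by move=> x y /h2/meet_translates.
Qed.

Lemma dual_strict_hadwiger_family :
  dual_strict_hadwiger C = family disc_norm (fun d => d < 1).
Proof.
apply/funext => S; apply/propext; split=> -[h1 h2 h3]; split => //.
- by move=> x /h1/touch_translate.
- by move=> x y /h2/overlap_translates.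
- by move=> x /h1/touch_translate.
- by move=> x y /h2/overlap_translates.
Qed.
End gauge.

Theorem proposition27 (R : realType) (C : set 'rV[R]_2) (hC : convex_disc C) :
  [/\ ~ parallelogram C -> dual_blocking_number C 11,
      parallelogram C -> dual_blocking_number C 8,
      ~ parallelogram C -> dual_strict_blocking_number C 12
    & parallelogram C -> dual_strict_blocking_number C 12].
Proof.
have weak n u : cyc_seq (disc_norm hC) (fun d => d <= 1) n u ->
    (forall m v, cyc_seq (disc_norm hC) (fun d => d <= 1) m v -> (m <= n)%N) ->
    dual_blocking_number C n.
  rewrite /dual_blocking_number (dual_hadwiger_family hC); apply: max_card_family => //.
  - by move=> d d' /le_trans h /h.
  - by move=> d /ltW.
have strict n u : cyc_seq (disc_norm hC) (fun d => d < 1) n u ->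
    (forall m v, cyc_seq (disc_norm hC) (fun d => d < 1) m v -> (m <= n)%N) ->
    dual_strict_blocking_number C n.
  rewrite /dual_strict_blocking_number (dual_strict_hadwiger_family hC).
  apply: max_card_family => //.
  - by move=> d d' /le_lt_trans h /h.
  - by move=> d /ltW.
have sqP := parallelogram_square hC.
split=> [np|/sqP sq|np|/sqP sq].
- have [|u uP] := @good_cyc_seq11 _ (disc_norm hC); first by move=> /sqP.
  by apply: (weak _ u uP) => m v; exact: cyc_seq_le11.
- have [u uP] := square_cyc_seq8 sq.
  by apply: (weak _ u uP) => m v; exact: cyc_seq_le8.
- have [|u uP] := @good_cyc_seq12 _ (disc_norm hC); first by move=> /sqP.
  by apply: (strict _ u uP) => m v; exact: cyc_seq_le12.
- have [u uP] := square_cyc_seq12 sq.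
  by apply: (strict _ u uP) => m v; exact: cyc_seq_le12.
Qed.
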